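(* Let $\mathfrak g$ be a finite-dimensional real Lie algebra, $\mathfrak h\subset\mathfrak g$ a Lie subalgebra, $G$ a Lie group with Lie algebra $\mathfrak g$, and $H\subset G$ the connected Lie subgroup with Lie algebra $\mathfrak h$. Let $\{h_1,\dots,h_l\}$ be a basis of $\mathfrak h$ and $(\lambda^1,\dots,\lambda^l)$ the induced linear coordinates on $\mathfrak h^*$. A smooth function $r:\mathfrak h^*\to\wedge^2\mathfrak g$ is a triangular dynamical $r$-matrix if and only if the bivector field $$\pi=\pi_{\mathfrak h^*}+\sum_i\frac{\partial}{\partial\lambda^i}\wedge\overrightarrow{h_i}+\overrightarrow{r(\lambda)}$$ is a Poisson tensor on $M=\mathfrak h^*\times G$.
   Context: A smooth function $r:\mathfrak h^*\to\wedge^2\mathfrak g$ is a triangular dynamical $r$-matrix if: (i) $r$ is $H$-equivariant, where $H$ acts on $\mathfrak h^*$ by the coadjoint action and on $\wedge^2\mathfrak g$ by the adjoint action; with the notation $\mathrm{Ad}_y^*\lambda=\lambda\circ \mathrm{Ad}_y$ this means $r(\mathrm{Ad}^*_{y^{-1}}\lambda)=\mathrm{Ad}_y\, r(\lambda)$ for all $y\in H$, $\lambda\in\mathfrak h^*$; and (ii) $\sum_i h_i\wedge\frac{\partial r}{\partial\lambda^i}-\frac12[r,r]=0$ in $\wedge^3\mathfrak g$, where $[\cdot,\cdot]:\wedge^k\mathfrak g\otimes\wedge^m\mathfrak g\to\wedge^{k+m-1}\mathfrak g$ is the Schouten bracket induced by the Lie bracket, $[a_1\wedge\dots\wedge a_k,b_1\wedge\dots\wedge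 b_m]=\sum_{i,j}(-1)^{i+j}[a_i,b_j]\wedge a_1\wedge\dots\widehat{a_i}\dots\wedge a_k\wedge b_1\wedge\dots\widehat{b_j}\dots\wedge b_m$. $\pi_{\mathfrak h^*}$ is the Lie--Poisson (Kirillov--Kostant) tensor on $\mathfrak h^*$, $\{\lambda_X,\lambda_Y\}=\lambda_{[X,Y]}$ where $\lambda_X$ is the linear function $\lambda\mapsto\langle\lambda,X\rangle$. $\overrightarrow{h_i}$ is the vector field on $M$ tangent to the $G$-factor which is the left-invariant vector field generated by $h_i$, and $\overrightarrow{r(\lambda)}$ is the bivector field on $M$ whose value at $(\lambda,x)$ is the left translate to $x$ (along the $G$-factor) of $r(\lambda)\in\wedge^2\mathfrak g$. *)

(* Defs.v *)
From HB Require Import structures.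
From mathcomp Require Import all_boot all_order all_algebra.
From mathcomp Require Import all_classical all_reals all_analysis.
From mathcomp Require Import ring.

Set Implicit Arguments.
Unset Strict Implicit.
Unset Printing Implicit Defensive.

Import Order.TTheory GRing.Theory Num.Theory.
Import numFieldNormedType.Exports.

Local Open Scope classical_set_scope.
Local Open Scope ring_scope.

Section Smoothness.
Context {R : realType} {V W : normedModType R}.

Fixpoint C_k (k : nat) (U : set V) (f : V -> W) : Prop :=
  match k with
  | 0 => forall x, U x -> {for x, continuous f}
  | k'.+1 => (forall x, U x -> differentiable f x) /\
             (forall v, C_k k' U ('D_v f))
  end.

(* meant for open sets U only: the derivatives are those of the total f *)
Definition smooth_on (U : set V) (f : V -> W) : Prop := forall k, C_k k U f.

End Smoothness.

(* [cmap] is meaningful on [cdom] only, and [cinv] on the image [crange]. *)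
Record chart (T E : Type) := Chart {
  cdom : set T;
  cmap : T -> E;
  cinv : E -> T }.

Definition crange (T E : Type) (c : chart T E) : set E := cmap c @` cdom c.

Definition id_chart (E : Type) : chart E E := Chart setT id id.

Definition prod_chart (S T E F : Type) (c : chart S E) (d : chart T F) :
    chart (S * T) (E * F) :=
  Chart (cdom c `*` cdom d)
    (fun p => (cmap c p.1, cmap d p.2)) (fun q => (cinv c q.1, cinv d q.2)).

Definition prod_atlas (S T E F : Type)
    (A : set (chart S E)) (B : set (chart T F)) :
    set (chart (S * T) (E * F)) :=
  [set e | exists c d, [/\ A c, B d & e = prod_chart c d]].

Definition topological_chart (T E : topologicalType) (c : chart T E) : Prop :=
  [/\ open (cdom c),
      open (crange c),
      (forall x, cdom c x -> cinv c (cmap c x) = x),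
      (forall x, cdom c x -> {for x, continuous (cmap c)}) &
      (forall u, crange c u -> {for u, continuous (cinv c)})].

Section SmoothMaps.
Context {R : realType}.

Definition smooth_compatible (T : Type) (E : normedModType R)
    (c d : chart T E) : Prop :=
  smooth_on (cmap c @` (cdom c `&` cdom d)) (cmap d \o cinv c).

Definition smooth_fun (T : Type) (E : normedModType R)
    (A : set (chart T E)) (f : T -> R) : Prop :=
  forall c, A c -> smooth_on (crange c) (f \o cinv c : E -> R^o).

Definition smooth_map (S T : topologicalType) (E F : normedModType R)
    (A : set (chart S E)) (B : set (chart T F)) (f : S -> T) : Prop :=
  continuous f /\
  forall c d, A c -> B d ->
    smooth_on (cmap c @` (cdom c `&` f @^-1` cdom d)) (cmap d \o f \o cinv c).

End SmoothMaps.

HB.mixin Record isManifold (R : realType) (n : nat) T of Topological T := {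
  atlas : set (chart T 'rV[R]_n);
  manifold_hausdorff : hausdorff_space T;
  manifold_second_countable : @second_countable T;
  atlas_chart : forall c, atlas c -> topological_chart c;
  atlas_cover : forall x : T, exists2 c, atlas c & cdom c x;
  atlas_compatible :
    forall c d, atlas c -> atlas d -> smooth_compatible c d }.

#[short(type="manifoldType")]
HB.structure Definition Manifold (R : realType) (n : nat) :=
  {T of Topological T & isManifold R n T}.

#[short(type="groupManifoldType")]
HB.structure Definition GroupManifold (R : realType) (n : nat) :=
  {T of Manifold R n T & Group T}.

HB.mixin Record isLieGroup (R : realType) (n : nat) T of GroupManifold R n T := {
  mulg_smooth :
    smooth_map (prod_atlas (@atlas R n T) (@atlas R n T)) (@atlas R n T)
      (fun p : T * T => (p.1 * p.2)%g);
  invg_smooth :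
    smooth_map (@atlas R n T) (@atlas R n T) (fun x : T => (x^-1)%g) }.

#[short(type="lieGroupType")]
HB.structure Definition LieGroup (R : realType) (n : nat) :=
  {T of GroupManifold R n T & isLieGroup R n T}.

(* A tangent vector at p is the velocity at time 0 of a smooth curve through p,
   seen as a derivation of the algebra of smooth functions.  Its values on
   functions that are not smooth are irrelevant. *)
Definition tangent_at (R : realType) (n : nat) (T : manifoldType R n)
    (p : T) (D : (T -> R) -> R) : Prop :=
  exists gamma : R -> T,
    [/\ smooth_map [set id_chart R^o] (@atlas R n T) gamma,
        gamma 0 = p &
        forall f, smooth_fun (@atlas R n T) f -> D f = derive1 (f \o gamma) 0].

Record lie_bracket (R : realType) (g : vectType R) (br : g -> g -> g) : Prop :=
  LieBracket {
    br_linearl : forall (a : R) x y z, br (a *: x + y) z = a *: br x z + br y z;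
    br_linearr : forall (a : R) x y z, br z (a *: x + y) = a *: br z x + br z y;
    brxx : forall x, br x x = 0;
    br_jacobi : forall x y z, br x (br y z) + br y (br z x) + br z (br x y) = 0 }.

Definition lie_subalgebra (R : realType) (g : vectType R) (br : g -> g -> g)
    (h : {vspace g}) : Prop :=
  forall x y, x \in h -> y \in h -> br x y \in h.

Section LieGroups.
Context {R : realType} {g : vectType R} {n : nat} {G : lieGroupType R n}.

Local Notation smoothG := (smooth_fun (@atlas R n G)).

(* For theta identifying g with the tangent space of G at 1, the left-invariant
   vector field generated by X. *)
Definition left_field (theta : g -> (G -> R) -> R) (X : g)
    (f : G -> R) (x : G) : R :=
  theta X (fun y => f (x * y)%g).

(* g is the Lie algebra of G: theta is a linear isomorphism from g onto the
   tangent space at 1, and the bracket of g is the commutator of the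
   left-invariant vector fields. *)
Record is_lie_algebra_of (br : g -> g -> g) (theta : g -> (G -> R) -> R) :
    Prop := IsLieAlgebraOf {
  theta_tangent : forall X, tangent_at (1%g : G) (theta X);
  theta_linear : forall (a : R) X Y f, smoothG f ->
    theta (a *: X + Y) f = a * theta X f + theta Y f;
  theta_inj : forall X Y,
    (forall f, smoothG f -> theta X f = theta Y f) -> X = Y;
  theta_surj : forall D, tangent_at (1%g : G) D ->
    exists X, forall f, smoothG f -> D f = theta X f;
  theta_bracket : forall X Y f, smoothG f ->
    theta (br X Y) f =
      theta X (left_field theta Y f) - theta Y (left_field theta X f) }.

(* (H, iota) is a connected (immersed) Lie subgroup of G whose tangent space
   at 1 is h. *)
Record is_connected_lie_subgroup (theta : g -> (G -> R) -> R) (h : {vspace g})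
    (m : nat) (H : lieGroupType R m) (iota : H -> G) : Prop :=
  IsConnectedLieSubgroup {
  iota_smooth : smooth_map (@atlas R m H) (@atlas R n G) iota;
  iota_morph : {morph iota : x y / (x * y)%g};
  iota_inj : injective iota;
  iota_immersion : forall (p : H) D D', tangent_at p D -> tangent_at p D' ->
    (forall f, smoothG f -> D (f \o iota) = D' (f \o iota)) ->
    forall f, smooth_fun (@atlas R m H) f -> D f = D' f;
  subgroup_connected : connected [set: H];
  subgroup_lie_algebra : forall X, X \in h <->
    exists2 D, tangent_at (1%g : H) D &
      forall f, smoothG f -> theta X f = D (f \o iota) }.

(* Ad_y X is the image of X under the differential at 1 of x |-> y x y^-1. *)
Definition Ad (theta : g -> (G -> R) -> R) (y : G) (X : g) : g :=
  xget 0 [set Z | forall f, smoothG f ->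
    theta Z f = theta X (fun x => f (y * x * y^-1)%g)].

End LieGroups.

Definition dual (R : realType) (V : vectType R) := 'Hom(V, R^o).

(* The second and third exterior powers of g are realized as the spaces of
   alternating bilinear, resp. trilinear, forms on the dual of g, with
   (a1 /\ ... /\ ak)(xi1, ..., xik) = det (xii(aj)). *)
Section Exterior.
Context {R : realType} {g : vectType R}.

Record bivector := Bivector {
  bivector_fun :> dual g -> dual g -> R;
  bivector_linearl : forall (a : R) xi xi' eta,
    bivector_fun (a *: xi + xi') eta =
      a * bivector_fun xi eta + bivector_fun xi' eta;
  bivector_linearr : forall (a : R) xi xi' eta,
    bivector_fun eta (a *: xi + xi') =
      a * bivector_fun eta xi + bivector_fun eta xi';
  bivector_alt : forall xi, bivector_fun xi xi = 0 }.

Definition wedge2 (a b : g) (xi eta : dual g) : R :=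
  xi a * eta b - xi b * eta a.

(* a /\ w for w in the second exterior power *)
Definition wedge12 (a : g) (w : dual g -> dual g -> R)
    (xi eta zeta : dual g) : R :=
  xi a * w eta zeta - eta a * w xi zeta + zeta a * w xi eta.

Definition wedge3 (a b c : g) : dual g -> dual g -> dual g -> R :=
  wedge12 a (wedge2 b c).

(* [a1 /\ a2, b1 /\ b2] *)
Definition schouten_decomposable (br : g -> g -> g) (a1 a2 b1 b2 : g)
    (xi eta zeta : dual g) : R :=
    wedge3 (br a1 b1) a2 b2 xi eta zeta - wedge3 (br a1 b2) a2 b1 xi eta zeta
  - wedge3 (br a2 b1) a1 b2 xi eta zeta + wedge3 (br a2 b2) a1 b1 xi eta zeta.

Definition gbasis : (\dim (fullv : {vspace g})).-tuple g := vbasis fullv.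

Definition gcoord (i : 'I_(\dim (fullv : {vspace g}))) : dual g :=
  linfun (coord gbasis i : g -> R^o).

(* Bilinear extension, using v = 1/2 \sum_(i, j) v(e^i, e^j) e_i /\ e_j;
   by [schouten_wedge2] below, the formula then holds on all decomposable
   bivectors. *)
Definition schouten (br : g -> g -> g) (v w : dual g -> dual g -> R)
    (xi eta zeta : dual g) : R :=
  4^-1 * \sum_i \sum_j \sum_k \sum_l
    v (gcoord i) (gcoord j) * w (gcoord k) (gcoord l) *
    schouten_decomposable br (tnth gbasis i) (tnth gbasis j)
      (tnth gbasis k) (tnth gbasis l) xi eta zeta.

Lemma gbasis_sum (x : g) : x = \sum_i gcoord i x *: tnth gbasis i.
Proof.
have ->: \sum_i gcoord i x *: tnth gbasis i =
  \sum_i coord gbasis i x *: (gbasis : seq g)`_i.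
  by apply: eq_bigr => i _; rewrite /gcoord lfunE /= (tnth_nth 0).
by apply: coord_vbasis; rewrite memvf.
Qed.

Let lin (f : g -> R) := forall (a : R) x y, f (a *: x + y) = a * f x + f y.

Let lin_expand f x : lin f -> f x = \sum_i gcoord i x * f (tnth gbasis i).
Proof.
move=> fl; rewrite [in LHS](gbasis_sum x).
have f0 : f 0 = 0.
  have := fl (-1) 0 0; rewrite scaler0 addr0 mulN1r addNr; exact.
by elim/big_rec2: _ => [//|i u v _ <-]; exact: fl.
Qed.

Let quad_expand (F : g -> g -> g -> g -> R) a b c d :
  (forall y z w, lin (fun x => F x y z w)) ->
  (forall x z w, lin (fun y => F x y z w)) ->
  (forall x y w, lin (fun z => F x y z w)) ->
  (forall x y z, lin (fun w => F x y z w)) ->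
  F a b c d = \sum_i \sum_j \sum_k \sum_l
    gcoord i a * gcoord j b * (gcoord k c * gcoord l d) *
    F (tnth gbasis i) (tnth gbasis j) (tnth gbasis k) (tnth gbasis l).
Proof.
move=> l1 l2 l3 l4; rewrite (lin_expand a (l1 b c d)).
apply: eq_bigr => i _; rewrite (lin_expand b (l2 _ c d)) mulr_sumr.
apply: eq_bigr => j _; rewrite (lin_expand c (l3 _ _ d)) !mulr_sumr.
apply: eq_bigr => k _; rewrite (lin_expand d (l4 _ _ _)) !mulr_sumr.
by apply: eq_bigr => q _; ring.
Qed.

Lemma schouten_wedge2 (br : g -> g -> g) (a1 a2 b1 b2 : g) xi eta zeta :
  lie_bracket br ->
  schouten br (wedge2 a1 a2) (wedge2 b1 b2) xi eta zeta =
  schouten_decomposable br a1 a2 b1 b2 xi eta zeta.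
Proof.
case=> brl brr _ _.
pose F x y z w := schouten_decomposable br x y z w xi eta zeta.
have ll (f : dual g) (a : R) x y : f (a *: x + y) = a * f x + f y.
  by rewrite linearP.
have l1 y z w : lin (fun x => F x y z w).
  move=> a x x'.
  by rewrite /F /schouten_decomposable /wedge3 /wedge12 /wedge2 !brl !ll; ring.
have l2 x z w : lin (fun y => F x y z w).
  move=> a y y'.
  by rewrite /F /schouten_decomposable /wedge3 /wedge12 /wedge2 !brl !ll; ring.
have l3 x y w : lin (fun z => F x y z w).
  move=> a z z'.
  by rewrite /F /schouten_decomposable /wedge3 /wedge12 /wedge2 !brr !ll; ring.
have l4 x y z : lin (fun w => F x y z w).
  move=> a w w'.
  by rewrite /F /schouten_decomposable /wedge3 /wedge12 /wedge2 !brr !ll; ring.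
have F12 x y z w : F y x z w = - F x y z w.
  by rewrite /F /schouten_decomposable /wedge3 /wedge12 /wedge2; ring.
have F34 x y z w : F x y w z = - F x y z w.
  by rewrite /F /schouten_decomposable /wedge3 /wedge12 /wedge2; ring.
have E x y z w := quad_expand x y z w l1 l2 l3 l4.
have -> : schouten_decomposable br a1 a2 b1 b2 xi eta zeta =
  4^-1 * (F a1 a2 b1 b2 - F a2 a1 b1 b2 - F a1 a2 b2 b1 + F a2 a1 b2 b1).
  rewrite !(F12 a1 a2) !(F34 _ _ b1 b2) -/(F _ _ _ _).
  by field.
rewrite /schouten; congr (_ * _); rewrite !E.
rewrite -!sumrB -big_split; apply: eq_bigr => i _ /=.
rewrite -!sumrB -big_split; apply: eq_bigr => j _ /=.
rewrite -!sumrB -big_split; apply: eq_bigr => k _ /=.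
rewrite -!sumrB -big_split; apply: eq_bigr => q _ /=.
by rewrite /F /wedge2; ring.
Qed.

End Exterior.
Arguments bivector {R} g.

Section DualOfSubalgebra.
Context {R : realType} {g : vectType R} (h : {vspace g}) {l : nat}.
Variable b : l.-tuple g.

Local Notation hdual := (dual (subvs_of h)).

(* the value of lambda at X, for X in h *)
Definition pairing (lambda : hdual) (X : g) : R := lambda (vsproj h X).

Definition dual_basis (i : 'I_l) : hdual :=
  linfun (coord b i \o vsval : subvs_of h -> R^o).

(* the global chart of the dual of h given by the coordinates
   lambda |-> lambda(b_i) *)
Definition dual_chart : chart hdual 'rV[R]_l :=
  Chart setT (fun lambda => \row_i pairing lambda (tnth b i))
    (fun u => \sum_i u 0 i *: dual_basis i).

Definition smooth_bivector_valued (r : hdual -> bivector g) : Prop :=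
  forall xi eta, smooth_fun [set dual_chart] (fun lambda => r lambda xi eta).

Definition dual_partial (i : 'I_l) (f : hdual -> R) (lambda : hdual) : R :=
  derive1 (fun t : R => f (lambda + t *: dual_basis i)) 0.

Context {n : nat} {G : lieGroupType R n}.
Variables (br : g -> g -> g) (theta : g -> (G -> R) -> R).

(* lambda \o Ad y, for y such that Ad y maps h to itself *)
Definition coAd (y : G) (lambda : hdual) : hdual :=
  linfun (fun X : subvs_of h => pairing lambda (Ad theta y (vsval X)) : R^o).

Definition Ad_bivector (y : G) (w : dual g -> dual g -> R)
    (xi eta : dual g) : R :=
  w (linfun (fun X => xi (Ad theta y X))) (linfun (fun X => eta (Ad theta y X))).

Definition triangular_dynamical_r_matrix (m : nat) (H : lieGroupType R m)
    (iota : H -> G) (r : hdual -> bivector g) : Prop :=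
  (forall (y : H) lambda xi eta,
     r (coAd (iota y)^-1%g lambda) xi eta =
     Ad_bivector (iota y) (r lambda) xi eta) /\
  (forall lambda xi eta zeta,
     \sum_i wedge12 (tnth b i)
        (fun xi' eta' => dual_partial i (fun mu => r mu xi' eta') lambda)
        xi eta zeta
     - 2^-1 * schouten br (r lambda) (r lambda) xi eta zeta = 0).

Local Notation M := (hdual * G)%type.

Definition M_atlas : set (chart M ('rV[R]_l * 'rV[R]_n)) :=
  prod_atlas [set dual_chart] (@atlas R n G).

(* Bivector fields are described by their values P(df, dk). *)
Definition wedge_field (X Y : (M -> R) -> M -> R) (f k : M -> R) (p : M) : R :=
  X f p * Y k p - X k p * Y f p.

Definition d_dlambda (i : 'I_l) (f : M -> R) (p : M) : R :=
  dual_partial i (fun lambda => f (lambda, p.2)) p.1.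

Definition arrow (X : g) (f : M -> R) (p : M) : R :=
  left_field theta X (fun y => f (p.1, y)) p.2.

(* The differential of f along the dual of h, as an element of h. *)
Definition dual_gradient (f : M -> R) (p : M) : g :=
  \sum_i d_dlambda i f p *: tnth b i.

Definition lie_poisson (f k : M -> R) (p : M) : R :=
  pairing p.1 (br (dual_gradient f p) (dual_gradient k p)).

(* On linear functions, this is the defining property of the Kirillov-Kostant
   bracket. *)
Lemma lie_poisson_linear X Y lambda (x : G) :
  basis_of h b -> X \in h -> Y \in h ->
  lie_poisson (fun p => pairing p.1 X) (fun p => pairing p.1 Y)
    ((lambda, x) : M) = pairing lambda (br X Y).
Proof.
move=> bh Xh Yh.
suff H Z : Z \in h ->
    dual_gradient (fun p : M => pairing p.1 Z) (lambda, x)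
    = Z by rewrite /lie_poisson !H.
move=> Zh; rewrite [RHS](coord_basis bh Zh) /dual_gradient.
apply: eq_bigr => i _; rewrite (tnth_nth 0); congr (_ *: _).
rewrite /d_dlambda /dual_partial /pairing /=.
have -> : (fun t : R => (lambda + t *: dual_basis i) (vsproj h Z) : R)
  = (fun t => lambda (vsproj h Z) + t * coord b i Z).
  apply: funext => t; rewrite add_lfunE scale_lfunE /dual_basis lfunE /=.
  by rewrite vsprojK.
rewrite derive1E deriveD// derive_cst add0r deriveM// derive_cst derive_id.
by rewrite scaler0 add0r /GRing.scale /= mulr1.
Qed.

(* The left translate to p.2 of r(p.1) is evaluated on df and dk by pulling
   these back to covectors on g by the left translation. *)
Definition arrow_bivector (r : hdual -> bivector g) (f k : M -> R) (p : M) : R :=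
  r p.1 (linfun (fun X => arrow X f p : R^o))
        (linfun (fun X => arrow X k p : R^o)).

Definition r_bivector_field (r : hdual -> bivector g) (f k : M -> R) (p : M) : R :=
  lie_poisson f k p
  + \sum_i wedge_field (d_dlambda i) (arrow (tnth b i)) f k p
  + arrow_bivector r f k p.

End DualOfSubalgebra.

Section Poisson.
Context {R : realType} {T : Type} {E : normedModType R}.
Variable A : set (chart T E).

Local Notation smooth := (smooth_fun A).

(* A bivector field, as an alternating biderivation of the smooth functions. *)
Record bivector_field (P : (T -> R) -> (T -> R) -> T -> R) : Prop :=
  BivectorField {
  bivector_field_smooth : forall f k, smooth f -> smooth k -> smooth (P f k);
  bivector_field_skew : forall f k x, smooth f -> smooth k ->
    P f k x = - P k f x;
  bivector_field_linear : forall (a : R) f f' k x,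
    smooth f -> smooth f' -> smooth k ->
    P (fun y => a * f y + f' y) k x = a * P f k x + P f' k x;
  bivector_field_leibniz : forall f f' k x,
    smooth f -> smooth f' -> smooth k ->
    P (fun y => f y * f' y) k x = f x * P f' k x + P f k x * f' x }.

Definition poisson_tensor (P : (T -> R) -> (T -> R) -> T -> R) : Prop :=
  bivector_field P /\
  forall f k q x, smooth f -> smooth k -> smooth q ->
    P f (P k q) x + P k (P q f) x + P q (P f k) x = 0.

End Poisson.

(* Main.v *)
Require Import Defs.
From HB Require Import structures.
From mathcomp Require Import all_boot all_order all_algebra.
From mathcomp Require Import all_classical all_reals all_analysis.
From mathcomp Require Import ring lra.

(** Why the theorem is true.

    Let P f k = sum over A and B of Pi_AB * E_A f * E_B k be a bivector field
    written in a frame of vector fields E_A.  In its Jacobiator, second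
    derivatives only occur through the commutators of the E_A
    ([frame_jacobiator]).  On M = h^* x G, take for frame the d/dlambda^i and
    the left-invariant fields of a basis of g, whose commutators are
    combinations of the frame with constant coefficients.  The Jacobiator of
    f, k, q at (lambda, x) is then a trilinear expression in the three
    differentials.  Each differential is a pair (X, xi), where X in h is the
    gradient along h^* and xi in g^* is the differential along G, translated
    to 1.  The computation ([cyclic_identity]) gives
      I(X_f; xi_k, xi_q) + I(X_k; xi_q, xi_f) + I(X_q; xi_f, xi_k)
        - YB(xi_f, xi_k, xi_q)
    where YB is the left-hand side of the dynamical Yang-Baxter equation, and
      I(X; xi, eta) = the derivative of r(xi, eta) along lambda o ad X
                      + r(xi o ad X, eta) + r(xi, eta o ad X)
    is the infinitesimal variation of r under X.  The remaining terms cancel,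
    by the Jacobi identity of g.

    Every pair (X, xi) is the differential at a given point of a smooth
    function on M ([covector_onto]): linear functions on h^* give X, and xi is
    reached because the differentials at 1 of the smooth functions on G separate
    the points of g ([cotangent_onto]).  Hence P is a Poisson tensor if and only
    if YB = 0 and I(X; ., .) = 0 for all X in h.

    It remains to see that r is H-equivariant if and only if I vanishes.
    Equivariance means that r(lambda o Ad y)(xi o Ad y, eta o Ad y) does not
    depend on y in H ([equivariant_invariant]).  The derivative of this function
    of y at 1 in the direction X is I(X; xi, eta), because the derivative of Ad
    at 1 is ad ([is_derive_Ad], [is_derive_transport]).  Conversely, if I
    vanishes, the function is constant on every smooth curve of H through 1:
    writing y(t + s) = y(t) z(s) moves the derivative at time t to 1
    ([invariant_curve]).  Such curves cover a neighborhood of 1, and the set of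
    the y leaving r invariant is a subgroup; so it is open and closed in the
    connected group H ([invariant_all]).

    The analysis needed is the stability of smooth functions under composition
    ([C_k_comp]) and the symmetry of second derivatives ([derive_comm]), which
    makes d/dlambda^i commute with the left-invariant fields and turns the
    derivative of Ad into a commutator. *)

Set Implicit Arguments.
Unset Strict Implicit.
Unset Printing Implicit Defensive.

Import Order.TTheory GRing.Theory Num.Theory numFieldNormedType.Exports.

Local Open Scope classical_set_scope.
Local Open Scope ring_scope.

(** * Functions of class C^k *)

Section Ck.
Context {R : realType}.
Implicit Types V W E : normedModType R.

Lemma C_kSE V W k (U : set V) (f : V -> W) : C_k k.+1 U f =
  ((forall x, U x -> differentiable f x) /\ forall v, C_k k U ('D_v f)).
Proof. by []. Qed.

Lemma C_k_sub V W k (U U' : set V) (f : V -> W) :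
  U' `<=` U -> C_k k U f -> C_k k U' f.
Proof.
elim: k f => [|k IH] f sub /=; first by move=> Cf x /sub /Cf.
by move=> [df Df]; split=> [x /sub /df|v]; [|exact: IH (Df v)].
Qed.

Lemma differentiable_near0 V W (f : V -> W) x :
  (\forall y \near x, f y = 0) -> differentiable f x.
Proof.
move=> f0; have fx0 : f x = 0 := nbhs_singleton f0.
have fo : f \o shift x = cst (f x) + (\0 : {linear V -> W}) +o_ 0 id.
  apply/eqaddoP => e e0; rewrite near_simpl; near=> y.
  rewrite !fctE /= fx0 addr0 subr0 (_ : f (y + x) = 0).
    by rewrite normr0 mulr_ge0 // ltW.
  near: y; move: f0; by rewrite (near_shift 0) /= subr0.
have df : 'd f x = (\0 : {linear V -> W}) :> (V -> W).
  by apply: diff_unique => //; exact: cst_continuous.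
by apply/diff_locallyP; rewrite df; split=> //; exact: cst_continuous.
Unshelve. all: by end_near. Qed.

Lemma near_eq_differentiable V W (f g : V -> W) x :
  (\forall y \near x, f y = g y) -> differentiable f x -> differentiable g x.
Proof.
move=> fg df; have -> : g = f + (g - f) by rewrite [RHS]addrC subrK.
apply: (differentiableD df); apply: differentiable_near0.
by near=> y; rewrite !fctE (near fg y) // subrr.
Unshelve. all: by end_near. Qed.

(** Only for open U: the derivatives are those of the total functions. *)
Lemma C_k_eq V W k (U : set V) (f g : V -> W) : open U ->
  (forall x, U x -> f x = g x) -> C_k k U f -> C_k k U g.
Proof.
move=> oU; have nearU x : U x -> \forall y \near x, U y.
  by move=> Ux; apply: open_nbhs_nbhs.
elim: k f g => [|k IH] f g fg /=.
  move=> cf x Ux.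
  have nfg : \forall y \near x, f y = g y by near=> y; apply: fg; near: y; exact: nearU.
  rewrite /prop_for /continuous_at -(fg _ Ux).
  by apply: cvg_trans (cf x Ux); apply: near_eq_cvg.
move=> [df Df]; split=> [x Ux|v].
  have nfg : \forall y \near x, f y = g y by near=> y; apply: fg; near: y; exact: nearU.
  exact: (near_eq_differentiable nfg (df _ Ux)).
apply: IH (Df v) => x Ux; apply: near_eq_derive.
by near=> y; apply: fg; near: y; exact: nearU.
Unshelve. all: by end_near. Qed.

Lemma C_kS V W k (U : set V) (f : V -> W) : C_k k.+1 U f -> C_k k U f.
Proof.
elim: k f => [|k IH] f [df Df] /=.
  by move=> x /df; exact: differentiable_continuous.
by split=> // v; apply: IH; exact: Df.
Qed.

Lemma C_k_cst V W k (U : set V) (a : W) : C_k k U (cst a : V -> W).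
Proof.
elim: k a => [|k IH] a /=; first by move=> x _; exact: cst_continuous.
split=> [x _|v]; first exact: differentiable_cst.
rewrite (_ : 'D_v (cst a) = cst 0); first exact: IH.
by apply/funext => x; rewrite derive_cst.
Qed.

Lemma C_k_add V W k (U : set V) (f g : V -> W) : open U ->
  C_k k U f -> C_k k U g -> C_k k U (fun x => f x + g x).
Proof.
move=> oU; elim: k f g => [|k IH] f g /=.
  by move=> cf cg x Ux; apply: continuousD; [exact: cf|exact: cg].
move=> [df Df] [dg Dg]; split=> [x Ux|v].
  by apply: (@differentiableD _ _ _ f g); [exact: df|exact: dg].
apply: C_k_eq (IH _ _ (Df v) (Dg v)) => // x Ux.
symmetry; apply: (@deriveD _ _ _ f g).
  exact/diff_derivable/df.
exact/diff_derivable/dg.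
Qed.

Lemma C_k_mul V k (U : set V) (f g : V -> R^o) : open U ->
  C_k k U f -> C_k k U g -> C_k k U (fun x => f x * g x : R^o).
Proof.
move=> oU; elim: k f g => [|k IH] f g.
  by move=> /= cf cg x Ux; apply: (@continuousM _ _ f g); [exact: cf|exact: cg].
move=> Cf Cg; have Cf' := C_kS Cf; have Cg' := C_kS Cg.
move: Cf Cg; rewrite !C_kSE => -[df Df] [dg Dg]; split=> [x Ux|v].
  by apply: (@differentiableM _ _ f g); [exact: df|exact: dg].
apply: (@C_k_eq _ _ _ _
  (fun x => f x * 'D_v g x + g x * 'D_v f x)) => //; last first.
  by apply: C_k_add => //; [exact: (IH f ('D_v g))|exact: (IH g ('D_v f))].
move=> x Ux; symmetry; apply: (@deriveM _ _ f g).
  exact/diff_derivable/df.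
exact/diff_derivable/dg.
Qed.

Lemma C_k_lin V W W' k (U : set V) (phi : {linear W -> W'}) (f : V -> W) :
  open U -> continuous phi -> C_k k U f -> C_k k U (fun x => phi (f x)).
Proof.
move=> oU cphi; elim: k f => [|k IH] f /=.
  by move=> cf x Ux; apply: continuous_comp; [exact: cf|exact: cphi].
move=> [df Df]; split=> [x Ux|v].
  apply: (@differentiable_comp _ _ _ _ f phi); first exact: df.
  exact: linear_differentiable.
apply: C_k_eq (IH _ (Df v)) => // x Ux.
have dphi : differentiable phi (f x) by exact: linear_differentiable.
rewrite !deriveE; [|exact: (@differentiable_comp _ _ _ _ f phi x (df _ Ux) dphi)|exact: df].
by rewrite (@diff_comp _ _ _ _ f phi x (df _ Ux) dphi) /= diff_lin.
Qed.

Lemma C_k_linear V W k (U : set V) (phi : {linear V -> W}) :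
  continuous phi -> C_k k U phi.
Proof.
move=> cphi; case: k => [|k] /=; first by move=> x _; exact: cphi.
split=> [x _|v]; first exact: linear_differentiable.
rewrite (_ : 'D_v phi = cst (phi v)); first exact: C_k_cst.
apply/funext => x; rewrite deriveE ?diff_lin //; exact: linear_differentiable.
Qed.

Lemma C_k_sum V W k (U : set V) N (f : 'I_N -> V -> W) : open U ->
  (forall i, C_k k U (f i)) -> C_k k U (fun x => \sum_i f i x).
Proof.
move=> oU; elim: N f => [|N IH] f Cf.
  rewrite (_ : (fun _ => _) = cst 0); first exact: C_k_cst.
  by apply/funext => x; rewrite big_ord0.
rewrite (_ : (fun _ => _) =
  (fun x => f ord0 x + \sum_i f (lift ord0 i) x)).
  by apply: C_k_add => //; apply: IH.
by apply/funext => x; rewrite big_ord_recl.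
Qed.

(** Finitely many continuous coordinates.  They turn the chain rule into a sum
    of products of scalar functions, to which an induction on k applies. *)
Definition framed E := exists N (e : 'I_N -> E) (phi : 'I_N -> {linear E -> R^o}),
  (forall i, continuous (phi i)) /\ forall x, x = \sum_i phi i x *: e i.

Lemma framed_real : framed (R^o : normedModType R).
Proof.
exists 1%N, (fun=> 1), (fun=> idfun : {linear R^o -> R^o}); split.
  by move=> _ x; exact: cvg_id.
by move=> x; rewrite big_ord1 /= /GRing.scale /= mulr1.
Qed.

Lemma C_k_scalel V W k (U : set V) (f : V -> R^o) (w : W) : open U ->
  C_k k U f -> C_k k U (fun x => f x *: w).
Proof.
move=> oU Cf.
have lin : linear (fun c : R^o => c *: w).
  by move=> a x y; rewrite scalerDl scalerA.
pose phiM := GRing.isLinear.Build _ _ _ _ _ lin.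
pose phi : {linear R^o -> W} := HB.pack (fun c : R^o => c *: w) phiM.
apply: (C_k_lin (phi := phi)) Cf => //.
exact: scalel_continuous.
Qed.

Lemma C_k_frame V E k (U : set V) (f : V -> E)
  N (e : 'I_N -> E) (phi : 'I_N -> {linear E -> R^o}) : open U ->
  (forall x, x = \sum_i phi i x *: e i) ->
  (forall i, C_k k U (fun x => phi i (f x) : R^o)) -> C_k k U f.
Proof.
move=> oU fr Cf.
rewrite (_ : f = (fun x => \sum_i phi i (f x) *: e i)).
  by apply: C_k_sum => // i; exact: C_k_scalel.
by apply/funext => x; rewrite -fr.
Qed.

(** After taking coordinates in W, the derivative of f \o g along v is the sum
    over i of phi_i (D_v g) * (D_(e_i) f \o g), whose factors are of class C^k
    by induction. *)
Lemma C_k_comp V E W k (U : set V) (O : set E) (g : V -> E) (f : E -> W) :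
  framed E -> framed W -> open U -> open O -> (forall x, U x -> O (g x)) ->
  C_k k U g -> C_k k O f -> C_k k U (f \o g).
Proof.
move=> [N [e [phi [cphi frE]]]] [N' [e' [psi [cpsi frW]]]] oU oO UO Cg Cf.
apply: (C_k_frame oU frW) => j /=.
have {}Cf : C_k k O (fun x => psi j (f x)) by exact: C_k_lin.
rewrite -[X in C_k _ _ X]/((fun x => psi j (f x) : R^o) \o g).
move: (fun x => psi j (f x) : R^o) Cf => f' Cf.
elim: k g f' UO Cg Cf => [|k IH] {}g f' UO.
  by move=> /= cg cf x Ux; apply: continuous_comp; [exact: cg|apply/cf/UO].
move=> Cg Cf; have Cg' := C_kS Cg; move: Cg Cf; rewrite !C_kSE => -[dg Dg] [df Df].
split=> [x Ux|v].
  by apply: differentiable_comp; [exact: dg|apply/df/UO].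
apply: (@C_k_eq _ _ _ _
  (fun x => \sum_i phi i ('D_v g x) * ('D_(e i) f' \o g) x)) => //; last first.
  apply: C_k_sum => // i; apply: C_k_mul => //; first exact: C_k_lin.
  exact: IH.
move=> x Ux; have dfx := df _ (UO _ Ux); have dgx := dg _ Ux.
rewrite [RHS]deriveE; last exact: differentiable_comp.
rewrite [RHS](congr1 (@^~ v) (diff_comp dgx dfx)) /= -(deriveE v dgx).
rewrite [X in _ = 'd f' _ X](frE ('D_v g x)) linear_sum /=.
by apply: eq_bigr => i _; rewrite linearZ /= -deriveE.
Qed.

End Ck.


(** * Smoothness at a point and symmetry of second derivatives *)

Section SmoothAt.
Context {R : realType}.
Implicit Types V W E : normedModType R.

Lemma framed_rV n : framed ('rV[R]_n : normedModType R).
Proof.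
pose phi (i : 'I_n) (u : 'rV[R]_n) : R^o := u 0 i.
have lin i : linear (phi i) by move=> a x y; rewrite /phi !mxE.
pose phiM i := GRing.isLinear.Build _ _ _ _ _ (lin i).
pose phiL i : {linear 'rV[R]_n -> R^o} := HB.pack (phi i) (phiM i).
exists n, (fun i => delta_mx 0 i), phiL; split=> [i|x].
  exact: coord_continuous.
exact: row_sum_delta.
Qed.

Lemma framed_pair V W : framed V -> framed W -> framed (V * W)%type.
Proof.
move=> [N [e [phi [cphi frV]]]] [N' [e' [psi [cpsi frW]]]].
pose F (i : 'I_N + 'I_N') : V * W -> R^o :=
  match i with inl j => phi j \o fst | inr j => psi j \o snd end.
have lin i : linear (F i).
  by case: i => j a x y /=; rewrite !linearP.
pose phiM i := GRing.isLinear.Build _ _ _ _ _ (lin i).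
pose phiL i : {linear (V * W)%type -> R^o} := HB.pack (F i) (phiM i).
pose ee (i : 'I_N + 'I_N') : V * W :=
  match i with inl j => (e j, 0) | inr j => (0, e' j) end.
exists (N + N')%N, (ee \o @fintype.split N N'), (phiL \o @fintype.split N N'); split=> [i|x] /=.
  rewrite /F; case: (fintype.split i) => j y.
    by apply: continuous_comp; [exact: cvg_fst|exact: cphi].
  by apply: continuous_comp; [exact: cvg_snd|exact: cpsi].
rewrite big_split_ord /=.
under eq_bigr do rewrite (unsplitK (inl _)).
under [X in _ + X]eq_bigr do rewrite (unsplitK (inr _)).
rewrite /F /ee /= [LHS]surjective_pairing [RHS]surjective_pairing.
congr pair.
  rewrite [RHS](linearD fst) !(linear_sum fst) /= -frV.
  by rewrite [X in _ + X]big1 ?addr0 // => i _; rewrite scaler0.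
rewrite [RHS](linearD snd) !(linear_sum snd) /= -frW.
by rewrite [X in X + _]big1 ?add0r // => i _; rewrite scaler0.
Qed.

(** Smoothness near a point: it composes without any bookkeeping of domains. *)
Definition smooth_at V W (x : V) (f : V -> W) :=
  exists U : set V, [/\ open U, U x & smooth_on U f].

Lemma smooth_onP V W (U : set V) (f : V -> W) : open U ->
  smooth_on U f <-> forall x, U x -> smooth_at x f.
Proof.
move=> oU; split=> [sf x Ux|sf k]; first by exists U.
have {}sf x : U x -> C_k k [set x] f.
  by move=> /sf [A [_ Ax sf']]; apply: C_k_sub (sf' k) => _ ->.
elim: k f sf => [|k IH] f sf /=; first by move=> x /sf; apply.
split=> [x /sf [+ _]|v]; first by apply.
by apply: IH => x /sf [_]; apply.
Qed.

Section Basic.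
Context {V W E : normedModType R}.
Implicit Types (f g : V -> W) (x : V).

Lemma smooth_at_eq x f g : (\forall y \near x, f y = g y) ->
  smooth_at x f -> smooth_at x g.
Proof.
move=> fg [U [oU Ux sf]].
exists (U `&` [set y | f y = g y]°); split.
- by apply: openI => //; exact: open_interior.
- by split=> //; exact: fg.
- move=> k; apply: (@C_k_eq _ _ _ _ _ f).
  + by apply: openI => //; exact: open_interior.
  + by move=> y [_ /interior_subset].
  + by apply: C_k_sub (sf k) => y [].
Qed.

Lemma smooth_at_continuous x f : smooth_at x f -> {for x, continuous f}.
Proof. by move=> [U [_ Ux /(_ 0%N)]]; apply. Qed.

Lemma smooth_at_differentiable x f : smooth_at x f -> differentiable f x.
Proof. by move=> [U [_ Ux /(_ 1%N)[+ _]]]; apply. Qed.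

Lemma smooth_at_derive v x f : smooth_at x f -> smooth_at x ('D_v f).
Proof.
by move=> [U [oU Ux sf]]; exists U; split=> // k; have [_] := sf k.+1; apply.
Qed.

Lemma smooth_at_cst x (a : W) : smooth_at x (fun=> a).
Proof. by exists setT; split=> //; [exact: openT|move=> k; exact: C_k_cst]. Qed.

Lemma smooth_at_linear x (phi : {linear V -> W}) :
  continuous phi -> smooth_at x phi.
Proof.
by move=> c; exists setT; split=> //; [exact: openT|move=> k; exact: C_k_linear].
Qed.

Lemma smooth_at_add x f g :
  smooth_at x f -> smooth_at x g -> smooth_at x (fun y => f y + g y).
Proof.
move=> [U [oU Ux sf]] [U' [oU' Ux' sg]]; exists (U `&` U'); split=> //.
  exact: openI.
move=> k; apply: C_k_add; first exact: openI.
  by apply: C_k_sub (sf k) => y [].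
by apply: C_k_sub (sg k) => y [].
Qed.

Lemma smooth_at_mul x (f g : V -> R^o) :
  smooth_at x f -> smooth_at x g -> smooth_at x (fun y => f y * g y : R^o).
Proof.
move=> [U [oU Ux sf]] [U' [oU' Ux' sg]]; exists (U `&` U'); split=> //.
  exact: openI.
move=> k; apply: C_k_mul; first exact: openI.
  by apply: C_k_sub (sf k) => y [].
by apply: C_k_sub (sg k) => y [].
Qed.

Lemma smooth_at_sum I (r : seq I) (P : pred I) x (f : I -> V -> W) :
  (forall i, P i -> smooth_at x (f i)) ->
  smooth_at x (fun y => \sum_(i <- r | P i) f i y).
Proof.
move=> sf; elim: r => [|i r IH].
  apply: smooth_at_eq (smooth_at_cst x 0); near=> y; by rewrite big_nil.
case Pi: (P i); last first.
  by apply: smooth_at_eq IH; near=> y; rewrite big_cons Pi.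
apply: smooth_at_eq (smooth_at_add (sf i Pi) IH).
by near=> y; rewrite big_cons Pi.
Unshelve. all: by end_near. Qed.

Lemma smooth_at_comp x (g : V -> E) (f : E -> W) : framed E -> framed W ->
  smooth_at x g -> smooth_at (g x) f -> smooth_at x (f \o g).
Proof.
move=> frE frW [U [oU Ux sg]] [A [oA Agx sf]].
exists ((U `&` g @^-1` A)°); split.
- exact: open_interior.
- apply: filterI; first exact: open_nbhs_nbhs.
  by apply: (sg 0%N) => //; exact: open_nbhs_nbhs.
- move=> k; apply: (@C_k_comp _ _ _ _ _ _ A) => //.
  + exact: open_interior.
  + by move=> y /interior_subset[].
  + by apply: C_k_sub (sg k) => y /interior_subset[].
Qed.

Lemma smooth_at_lin x (phi : {linear W -> E}) f : continuous phi ->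
  smooth_at x f -> smooth_at x (fun y => phi (f y)).
Proof.
by move=> cphi [U [oU Ux sf]]; exists U; split=> // k; apply: C_k_lin.
Qed.

End Basic.

Lemma smooth_at_pair V W E (x : V) (f : V -> W) (g : V -> E) :
  smooth_at x f -> smooth_at x g -> smooth_at x (fun y => (f y, g y)).
Proof.
have lin1 : linear (fun u : W => (u, 0 : E)).
  by move=> a u v; rewrite [RHS]surjective_pairing /= scaler0 addr0.
have lin2 : linear (fun u : E => (0 : W, u)).
  by move=> a u v; rewrite [RHS]surjective_pairing /= scaler0 addr0.
pose p1M := GRing.isLinear.Build _ _ _ _ _ lin1.
pose p1 : {linear W -> (W * E)%type} := HB.pack (fun u : W => (u, 0 : E)) p1M.
pose p2M := GRing.isLinear.Build _ _ _ _ _ lin2.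
pose p2 : {linear E -> (W * E)%type} := HB.pack (fun u : E => (0 : W, u)) p2M.
move=> sf sg.
have c1 : continuous p1.
  by move=> u; apply: cvg_pair; [exact: cvg_id|exact: cvg_cst].
have c2 : continuous p2.
  by move=> u; apply: cvg_pair; [exact: cvg_cst|exact: cvg_id].
apply: smooth_at_eq (smooth_at_add (smooth_at_lin c1 sf) (smooth_at_lin c2 sg)).
by near=> y; rewrite /= [LHS]surjective_pairing /= addr0 add0r.
Unshelve. all: by end_near. Qed.

Lemma smooth_at_id V (x : V) : smooth_at x id.
Proof. by apply: (@smooth_at_linear _ _ _ idfun) => y; exact: cvg_id. Qed.

Lemma smooth_at_fst V W (x : V * W) : smooth_at x fst.
Proof. by apply: smooth_at_linear => y; exact: cvg_fst. Qed.

Lemma smooth_at_snd V W (x : V * W) : smooth_at x snd.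
Proof. by apply: smooth_at_linear => y; exact: cvg_snd. Qed.

Lemma smooth_at_rV V n (x : V) (f : V -> 'rV[R]_n) :
  smooth_at x f <-> forall i, smooth_at x (fun y => f y 0 i : R^o).
Proof.
split=> [sf i|sf].
  have lin : linear (fun u : 'rV[R]_n => u 0 i : R^o).
    by move=> a u v; rewrite !mxE.
  pose phiM := GRing.isLinear.Build _ _ _ _ _ lin.
  pose phi : {linear 'rV[R]_n -> R^o} := HB.pack (fun u : 'rV[R]_n => u 0 i : R^o) phiM.
  by apply: (smooth_at_lin (phi := phi)) sf; exact: coord_continuous.
have sc (i : 'I_n) : smooth_at x (fun y => f y 0 i *: delta_mx 0 i : 'rV[R]_n).
  have lin : linear (fun c : R^o => c *: delta_mx 0 i : 'rV[R]_n).
    by move=> a u v; rewrite scalerDl scalerA.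
  pose phiM := GRing.isLinear.Build _ _ _ _ _ lin.
  pose phi : {linear R^o -> 'rV[R]_n} := HB.pack (fun c : R^o => c *: delta_mx 0 i : 'rV[R]_n) phiM.
  by apply: (smooth_at_lin (phi := phi)) (sf i); exact: scalel_continuous.
apply: smooth_at_eq (smooth_at_sum (index_enum 'I_n) (P := predT) (fun i _ => sc i)).
by near=> y; rewrite [RHS]row_sum_delta.
Unshelve. all: by end_near. Qed.

Lemma derive_lincomb V (a : R) (f k : V -> R^o) (x v : V) :
  differentiable f x -> differentiable k x ->
  'D_v (fun y => a * f y + k y : R^o) x = a * 'D_v f x + 'D_v k x.
Proof.
move=> df dk; have dvf := diff_derivable (v := v) df.
have dvk := diff_derivable (v := v) dk.
have dvaf : derivable (a *: f) x v by exact: derivableZ.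
by have := deriveD dvaf dvk; rewrite (deriveZ _ dvf).
Qed.

Lemma derive_mulf V (f k : V -> R^o) (x v : V) :
  differentiable f x -> differentiable k x ->
  'D_v (fun y => f y * k y : R^o) x = f x * 'D_v k x + 'D_v f x * k x.
Proof.
move=> df dk; rewrite [X in _ + X]mulrC.
exact: (deriveM (diff_derivable df) (diff_derivable dk)).
Qed.

Lemma is_derive_line V (f : V -> R^o) (y v : V) (t : R) :
  differentiable f (y + t *: v) ->
  is_derive t (1 : R) (fun s : R => f (y + s *: v) : R) ('D_v f (y + t *: v)).
Proof.
move=> df; have := diff_derivable (v := v) df.
have E : (fun h : R => h^-1 *: (f (y + (h *: 1 + t) *: v) - f (y + t *: v)) : R^o)
  = (fun h => h^-1 *: (f (h *: v + (y + t *: v)) - f (y + t *: v))).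
  apply/funext => h; congr (_ *: (f _ - _)).
  by rewrite scalerDl addrCA; congr (_ + _); rewrite /GRing.scale /= mulr1.
move=> dv; split; first by rewrite /derivable E.
by rewrite /derive E.
Qed.

Lemma derive1_line V (f : V -> R^o) (y v : V) :
  derive1 (fun s : R => f (y + s *: v) : R) 0 = 'D_v f y.
Proof.
have E : (fun h : R => h^-1 *: (f (y + (h + 0) *: v) - f (y + 0 *: v)) : R)
  = (fun h => h^-1 *: (f (h *: v + y) - f y)).
  by apply/funext => h; rewrite addr0 scale0r addr0 [y + _]addrC.
by rewrite /derive1 /derive E.
Qed.

(** The mean value theorem, applied in the direction v to the difference of f
    along t *: w, then in the direction w to the derivative found. *)
Lemma mixed_difference V (f : V -> R^o) (U : set V) (x v w : V) (s t : R) :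
  smooth_on U f -> 0 < s -> 0 < t ->
  (forall a b, 0 <= a <= s -> 0 <= b <= t -> U (x + a *: v + b *: w)) ->
  exists a b, [/\ 0 <= a <= s, 0 <= b <= t &
   f (x + s *: v + t *: w) - f (x + s *: v) - (f (x + t *: w) - f x) =
   'D_w ('D_v f) (x + a *: v + b *: w) * t * s].
Proof.
move=> sf s0 t0 inU.
have d0 y : U y -> differentiable f y by have [+ _] := sf 1%N; apply.
have d1 y : U y -> differentiable ('D_v f) y.
  by have [_ /(_ v)[+ _]] := sf 2%N; apply.
have U1 a : 0 <= a <= s -> U (x + a *: v).
  by move=> ?; have := inU a 0; rewrite scale0r addr0; apply; rewrite // lexx ltW.
have U2 a : 0 <= a <= s -> U (x + t *: w + a *: v).
  by move=> ?; rewrite addrAC; apply: inU => //; rewrite lexx ltW.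
pose g (a : R) : R := f (x + t *: w + a *: v) - f (x + a *: v).
pose dg (a : R) : R := 'D_v f (x + t *: w + a *: v) - 'D_v f (x + a *: v).
have Dg a : 0 <= a <= s -> is_derive a (1 : R) g (dg a).
  move=> ?; apply: is_deriveB; apply: is_derive_line; apply: d0.
    exact: U2.
  exact: U1.
have [||a as_ Ea] := MVT (f := g) (df := dg) s0.
- by move=> a /[!in_itv] /= /andP[? ?]; apply: Dg; rewrite !ltW.
- apply: derivable_within_continuous => a /[!in_itv] /= ?.
  by have [] := Dg a.
have {}as_ : 0 <= a <= s by move: as_; rewrite in_itv /= => /andP[? ?]; rewrite !ltW.
pose k (b : R) : R := 'D_v f (x + a *: v + b *: w).
have Dk b : 0 <= b <= t -> is_derive b (1 : R) k ('D_w ('D_v f) (x + a *: v + b *: w)).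
  by move=> ?; apply: is_derive_line; apply: d1; exact: inU.
have [||b bt Eb] := MVT (f := k) (df := fun b => 'D_w ('D_v f) (x + a *: v + b *: w)) t0.
- by move=> b /[!in_itv] /= /andP[? ?]; apply: Dk; rewrite !ltW.
- apply: derivable_within_continuous => b /[!in_itv] /= ?.
  by have [] := Dk b.
exists a, b; split=> //.
  by move: bt; rewrite in_itv /= => /andP[? ?]; rewrite !ltW.
move: Ea Eb; rewrite /g /dg /k !subr0 !scale0r !addr0.
by rewrite [x + t *: w + s *: v]addrAC [x + t *: w + a *: v]addrAC => -> ->.
Qed.

Lemma near_plane V (x v w : V) (P : set V) : (\forall y \near x, P y) ->
  exists2 d : R, 0 < d & forall a b : R, 0 <= a <= d / 2 -> 0 <= b <= d / 2 ->
    P (x + a *: v + b *: w).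
Proof.
move=> nP.
have cL : {for (0, 0), continuous (fun p : R * R => x + p.1 *: v + p.2 *: w)}.
  apply: (@continuousD _ _ _ (fun p : R * R => x + p.1 *: v) (fun p : R * R => p.2 *: w)).
    apply: (@continuousD _ _ _ (fun p : R * R => x) (fun p : R * R => p.1 *: v)).
      exact: cst_continuous.
    by apply: (@continuousZl _ _ _ (fun p : R * R => p.1) v); exact: cvg_fst.
  by apply: (@continuousZl _ _ _ (fun p : R * R => p.2) w); exact: cvg_snd.
have : \forall p \near (0 : R, 0 : R), P (x + p.1 *: v + p.2 *: w).
  by apply: cL; rewrite /= !scale0r !addr0.
move=> /nbhs_ballP[d /= d0 Pd]; exists d => // a b ha hb.
apply: (Pd (a, b)); split=> /=; rewrite -ball_normE /= sub0r normrN ger0_norm; lra.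
Qed.

(** Symmetry of second derivatives: by [mixed_difference], the second
    difference of f over a small parallelogram at x is the same multiple of a
    nearby value of each of the two mixed derivatives, which are continuous. *)
Lemma derive_comm V (f : V -> R^o) (x v w : V) : smooth_at x f ->
  'D_w ('D_v f) x = 'D_v ('D_w f) x.
Proof.
move=> sf; have sfvw := smooth_at_derive w (smooth_at_derive v sf).
have sfwv := smooth_at_derive v (smooth_at_derive w sf).
case: sf => U [oU Ux sf].
apply/eqP; rewrite -subr_eq0 -normr_le0; apply/ler_addgt0Pl => e e0; rewrite addr0.
have e20 : 0 < e / 2 by rewrite divr_gt0.
pose P y := [/\ U y, `|'D_w ('D_v f) x - 'D_w ('D_v f) y| < e / 2 &
   `|'D_v ('D_w f) x - 'D_v ('D_w f) y| < e / 2].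
have nP : \forall y \near x, P y.
  have /cvgr_dist_lt /(_ _ e20) n1 := smooth_at_continuous sfvw.
  have /cvgr_dist_lt /(_ _ e20) n2 := smooth_at_continuous sfwv.
  have n0 : \forall y \near x, U y by exact: open_nbhs_nbhs.
  apply: filterS (filterI n0 (filterI n1 n2)) => y [Uy [y1 y2]].
  by split; [exact: Uy|exact: y1|exact: y2].
have [d d0 inP] := near_plane v w nP.
have d20 : 0 < d / 2 by rewrite divr_gt0.
have [|a [b [ha hb E1]]] := @mixed_difference V f U x v w _ _ sf d20 d20.
  by move=> a b ha hb; case: (inP a b ha hb).
have [|a' [b' [ha' hb' E2]]] := @mixed_difference V f U x w v _ _ sf d20 d20.
  by move=> a' b' ha' hb'; rewrite addrAC; case: (inP b' a' hb' ha').
have [_ h1 _] := inP _ _ ha hb.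
have [_ _ h2] : P (x + a' *: w + b' *: v) by rewrite addrAC; exact: inP.
move: h1 h2 E1 E2 {nP inP P sfvw sfwv}.
rewrite [x + (d / 2) *: w + _]addrAC.
move: ('D_w ('D_v f) (x + a *: v + b *: w)) => A.
move: ('D_v ('D_w f) (x + a' *: w + b' *: v)) => B.
move: ('D_w ('D_v f) x) ('D_v ('D_w f) x) => C D h1 h2 E1 E2.
have d2 : d / 2 != 0 by rewrite gt_eqF.
have AB : A = B.
  by apply: (mulIf d2); apply: (mulIf d2); rewrite -E1 -E2; ring.
rewrite -AB in h2; have -> : C - D = (C - A) - (D - A) by ring.
by apply: (le_trans (ler_normB _ _)); lra.
Qed.

End SmoothAt.


(** * Charts and maps into a manifold *)

Section Charts.
Context {R : realType}.
Implicit Types V E F : normedModType R.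

Lemma smooth_on_at V E (S : set V) (x : V) (f : V -> E) :
  nbhs x S -> smooth_on S f -> smooth_at x f.
Proof.
move=> nS sf; exists S°; split=> //; first exact: open_interior.
by move=> k; apply: C_k_sub (sf k); exact: interior_subset.
Qed.

(** Smoothness of functions on a manifold, of maps between manifolds and of
    changes of charts all say that Phi is smooth when its source is read in a
    chart c.  Then Phi \o y is smooth whenever y is smooth in the chart c. *)
Lemma smooth_at_chart V E F (T : topologicalType) (c : chart T E) (K : set T)
    (Phi : T -> F) (x : V) (y : V -> T) :
  framed E -> framed F -> topological_chart c -> open K ->
  smooth_on (cmap c @` (cdom c `&` K)) (Phi \o cinv c) ->
  {for x, continuous y} -> smooth_at x (cmap c \o y) ->
  cdom c (y x) -> K (y x) -> smooth_at x (Phi \o y).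
Proof.
move=> frE frF [oD oR cK cc ic] oK sPhi cy scy Dyx Kyx.
pose u := cmap c (y x).
have Ru : crange c u by exists (y x).
have sPhi' : smooth_at u (Phi \o cinv c).
  apply: smooth_on_at sPhi.
  have n1 : \forall v \near u, crange c v by exact: open_nbhs_nbhs.
  have n2 : \forall v \near u, K (cinv c v).
    by apply: (ic u Ru); rewrite /u cK //; exact: open_nbhs_nbhs.
  apply: filterS (filterI n1 n2) => v [[s Ds sv] Kv].
  by exists s => //; split=> //; rewrite -(cK s Ds) sv.
have sc := smooth_at_comp frE frF scy sPhi'.
apply: smooth_at_eq sc.
have n : \forall z \near x, cdom c (y z) by apply: cy; exact: open_nbhs_nbhs.
by apply: filterS n => z Dz; rewrite /= cK.
Qed.

Lemma open_setX (S T : topologicalType) (A : set S) (B : set T) :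
  open A -> open B -> open (A `*` B).
Proof.
move=> oA oB; rewrite openE => -[s t] [/= As Bt].
by exists (A, B); [split; exact: open_nbhs_nbhs|].
Qed.

Lemma prod_topological_chart (S T : topologicalType) E F
    (c : chart S E) (d : chart T F) :
  topological_chart c -> topological_chart d ->
  topological_chart (prod_chart c d : chart (S * T)%type (E * F)%type).
Proof.
move=> [oD oR cK cc ic] [oD' oR' cK' cc' ic'].
have rangeE : crange (prod_chart c d) = crange c `*` crange d.
  apply/seteqP; split=> [_ [[s t] [/= Ds Dt] <-]|[u v] [[s Ds /= su] [t Dt /= tv]]].
    by split; [exists s|exists t].
  by exists (s, t) => //=; rewrite su tv.
split=> /=.
- exact: open_setX.
- by rewrite rangeE; exact: open_setX.
- by case=> s t [/= Ds Dt] /=; rewrite cK // cK'.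
- move=> [s t] [/= Ds Dt]; apply: cvg_pair.
    by apply: (continuous_comp (f := fst)); [exact: cvg_fst|exact: cc].
  by apply: (continuous_comp (f := snd)); [exact: cvg_snd|exact: cc'].
- move=> [s t]; rewrite rangeE => -[/= Rs Rt]; apply: cvg_pair.
    by apply: (continuous_comp (f := fst)); [exact: cvg_fst|exact: ic].
  by apply: (continuous_comp (f := snd)); [exact: cvg_snd|exact: ic'].
Qed.

Section FunctionAlgebra.
Context {T : Type} {E : normedModType R} {A : set (chart T E)}.
Hypothesis openA : forall c, A c -> open (crange c).
Implicit Types f k : T -> R.

Lemma smooth_fun_cst (a : R) : smooth_fun A (fun=> a).
Proof. by move=> c Ac i; exact: C_k_cst. Qed.

Lemma smooth_fun_add f k : smooth_fun A f -> smooth_fun A k ->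
  smooth_fun A (fun x => f x + k x).
Proof.
move=> sf sk c Ac i.
exact: C_k_add (openA Ac) (sf c Ac i) (sk c Ac i).
Qed.

Lemma smooth_fun_mul f k : smooth_fun A f -> smooth_fun A k ->
  smooth_fun A (fun x => f x * k x).
Proof.
move=> sf sk c Ac i.
exact: C_k_mul (openA Ac) (sf c Ac i) (sk c Ac i).
Qed.

Lemma smooth_fun_linear a f k : smooth_fun A f -> smooth_fun A k ->
  smooth_fun A (fun x => a * f x + k x).
Proof.
by move=> sf; apply: smooth_fun_add; apply: smooth_fun_mul => //; exact: smooth_fun_cst.
Qed.

Lemma smooth_fun_opp f : smooth_fun A f -> smooth_fun A (fun x => - f x).
Proof.
move=> sf; have := smooth_fun_mul (smooth_fun_cst (-1)) sf.
by congr smooth_fun; apply/funext => x; rewrite mulN1r.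
Qed.

Lemma smooth_fun_sum I (r : seq I) (P : pred I) (f : I -> T -> R) :
  (forall i, smooth_fun A (f i)) -> smooth_fun A (fun x => \sum_(i <- r | P i) f i x).
Proof.
move=> sf; elim: r => [|i r IH].
  have := smooth_fun_cst 0; congr smooth_fun.
  by apply/funext => x; rewrite big_nil.
case Pi : (P i).
  have := smooth_fun_add (sf i) IH; congr smooth_fun.
  by apply/funext => x; rewrite big_cons Pi.
by move: IH; congr smooth_fun; apply/funext => x; rewrite big_cons Pi.
Qed.

End FunctionAlgebra.

End Charts.

Section IntoManifold.
Context {R : realType} {n : nat} {T : manifoldType R n}.
Implicit Types V E F : normedModType R.

(** Smoothness at x of a map from a normed space to T, tested in all the charts
    around y x.  Maps with values in groups are handled through this notion
    only; charts of the source are themselves given by such maps. *)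
Definition smooth_into V (x : V) (y : V -> T) :=
  {for x, continuous y} /\
  forall d, atlas d -> cdom d (y x) -> smooth_at x (cmap d \o y).

Lemma smooth_into_cst V (x : V) (p : T) : smooth_into x (fun=> p).
Proof.
split=> [|d _ _]; first exact: cst_continuous.
exact: (smooth_at_cst x (cmap d p)).
Qed.

Lemma smooth_into_chart (c : chart T 'rV[R]_n) (u : 'rV[R]_n) :
  atlas c -> crange c u -> smooth_into u (cinv c).
Proof.
move=> Ac Ru; have tc := atlas_chart _ Ac.
have [oD oR cK cc ic] := tc.
have Du : cdom c (cinv c u) by case: Ru => s Ds <-; rewrite cK.
split=> [|d Ad Dd]; first exact: ic.
apply: (smooth_at_chart _ _ tc _ (atlas_compatible _ _ Ac Ad)) => //.
- exact: framed_rV.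
- exact: framed_rV.
- by have [] := atlas_chart _ Ad.
- exact: ic.
- apply: smooth_at_eq (smooth_at_id u).
  have nR : \forall v \near u, crange c v by exact: open_nbhs_nbhs.
  by apply: filterS nR => v [s Ds <-]; rewrite /= cK.
Qed.

Lemma smooth_into_comp V E (x : V) (g : V -> E) (y : E -> T) : framed E ->
  smooth_at x g -> smooth_into (g x) y -> smooth_into x (y \o g).
Proof.
move=> frE sg [cy sy]; split.
  by apply: continuous_comp => //; exact: smooth_at_continuous.
move=> d Ad Dd; rewrite compA; apply: smooth_at_comp => //.
  exact: framed_rV.
exact: sy.
Qed.

Lemma smooth_fun_into V (x : V) (y : V -> T) (f : T -> R) :
  smooth_fun (@atlas R n T) f -> smooth_into x y -> smooth_at x (f \o y : V -> R^o).
Proof.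
move=> sf [cy sy]; have [c Ac Dc] := atlas_cover (y x).
apply: (smooth_at_chart (c := c) (K := setT)) => //.
- exact: framed_rV.
- exact: framed_real.
- exact: atlas_chart.
- exact: openT.
- by rewrite setIT; exact: sf.
- exact: sy.
Qed.

Lemma smooth_funP (f : T -> R) :
  smooth_fun (@atlas R n T) f <->
  forall c u, atlas c -> crange c u -> smooth_at u (f \o cinv c : _ -> R^o).
Proof.
split=> [sf c u Ac Ru|sf c Ac].
  by apply: smooth_fun_into => //; exact: smooth_into_chart.
apply/smooth_onP; first by have [] := atlas_chart _ Ac.
by move=> u Ru; exact: sf.
Qed.

Lemma smooth_curveP (y : R -> T) :
  smooth_map [set id_chart R^o] (@atlas R n T) y <->
  forall t : R^o, smooth_into t (y : R^o -> T).
Proof.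
split=> [[cy sy] t|sy].
  split=> [|d Ad Dd]; first exact: cy.
  apply: smooth_on_at (sy _ d erefl Ad).
  rewrite /= (_ : _ @` _ = y @^-1` cdom d).
    by apply: cy; apply: open_nbhs_nbhs; split=> //; have [] := atlas_chart _ Ad.
  by rewrite setTI image_id.
split=> [t|_ d -> Ad]; first exact: (sy t).1.
rewrite /= setTI image_id.
apply/smooth_onP => [|t /= Dt]; last by have [_] := sy t; apply.
move/continuousP : (fun t => (sy t).1) => /(_ (cdom d)); apply.
by have [] := atlas_chart _ Ad.
Qed.

Lemma atlas_open (c : chart T 'rV[R]_n) : atlas c -> open (crange c).
Proof. by move=> /atlas_chart []. Qed.

End IntoManifold.

Section SmoothMapsInto.
Context {R : realType} {m n : nat} {S : manifoldType R m} {T : manifoldType R n}.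

Lemma smooth_map_into (V : normedModType R) (x : V) (y : V -> S) (phi : S -> T) :
  smooth_map (@atlas R m S) (@atlas R n T) phi ->
  smooth_into x y -> smooth_into x (phi \o y).
Proof.
move=> [cphi sphi] [cy sy]; split; first by apply: continuous_comp => //; exact: cphi.
move=> d Ad Dd; have [c Ac Dc] := atlas_cover (y x).
rewrite compA; apply: (smooth_at_chart (c := c) (K := phi @^-1` cdom d)) => //.
- exact: framed_rV.
- exact: framed_rV.
- exact: atlas_chart.
- by move/continuousP: cphi; apply; have [] := atlas_chart _ Ad.
- exact: sphi.
- exact: sy.
Qed.

Lemma smooth_fun_comp (phi : S -> T) (f : T -> R) :
  smooth_map (@atlas R m S) (@atlas R n T) phi ->
  smooth_fun (@atlas R n T) f -> smooth_fun (@atlas R m S) (f \o phi).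
Proof.
move=> sphi sf; apply/smooth_funP => c u Ac Ru.
rewrite -compA; apply: smooth_fun_into => //; apply: smooth_map_into => //.
exact: smooth_into_chart.
Qed.

End SmoothMapsInto.

Section LieGroupMaps.
Context {R : realType} {n : nat} {G : lieGroupType R n}.
Implicit Types V : normedModType R.

Lemma smooth_into_mul V (x : V) (y z : V -> G) :
  smooth_into x y -> smooth_into x z -> smooth_into x (fun u => (y u * z u)%g).
Proof.
have [cm sm] := @mulg_smooth R n G.
move=> [cy sy] [cz sz]; have cyz : {for x, continuous (fun u => (y u, z u))}.
  by apply: cvg_pair.
split=> [|d Ad Dd].
  exact: (@continuous_comp _ _ _ (fun u => (y u, z u)) (fun p : G * G => (p.1 * p.2)%g) x cyz (cm _)).
have [c1 A1 D1] := atlas_cover (y x); have [c2 A2 D2] := atlas_cover (z x).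
apply: (smooth_at_chart (c := prod_chart c1 c2) (y := fun u => (y u, z u))
  (K := (fun p : G * G => (p.1 * p.2)%g) @^-1` cdom d)
  (Phi := cmap d \o (fun p : G * G => (p.1 * p.2)%g))) => //.
- by apply: framed_pair; exact: framed_rV.
- exact: framed_rV.
- by apply: prod_topological_chart; exact: atlas_chart.
- by move/continuousP: cm; apply; have [] := atlas_chart _ Ad.
- by apply: sm => //; exists c1, c2.
- by apply: smooth_at_pair; [exact: sy|exact: sz].
Qed.

Lemma smooth_into_inv V (x : V) (y : V -> G) :
  smooth_into x y -> smooth_into x (fun u => (y u)^-1%g).
Proof. exact: smooth_map_into (@invg_smooth R n G). Qed.

Lemma smooth_fun_translate (x z : G) (f : G -> R) :
  smooth_fun (@atlas R n G) f -> smooth_fun (@atlas R n G) (fun y => f (x * y * z)%g).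
Proof.
move=> sf; apply/smooth_funP => c u Ac Ru.
apply: (smooth_fun_into (y := fun u => (x * cinv c u * z)%g)) => //.
apply: smooth_into_mul; last exact: smooth_into_cst.
apply: smooth_into_mul; first exact: smooth_into_cst.
exact: smooth_into_chart.
Qed.

End LieGroupMaps.


(** * The Lie algebra of a Lie group and the derivative of Ad *)

Section Partials.
Context {R : realType}.
Implicit Types V E F : normedModType R.

Lemma derive1_snd V (F : V * R^o -> R^o) (u : V) :
  derive1 (fun t : R => F (u, t) : R) 0 = 'D_((0, 1)) F (u, 0).
Proof.
rewrite -derive1_line; congr (derive1 _ 0); apply/funext => t; congr F.
by rewrite [RHS]surjective_pairing /= scaler0 addr0 add0r /GRing.scale /= mulr1.
Qed.

Lemma derive1_fst V (F : R^o * V -> R^o) (u : V) :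
  derive1 (fun t : R => F (t, u) : R) 0 = 'D_((1, 0)) F (0, u).
Proof.
rewrite -derive1_line; congr (derive1 _ 0); apply/funext => t; congr F.
by rewrite [RHS]surjective_pairing /= scaler0 addr0 add0r /GRing.scale /= mulr1.
Qed.

Lemma smooth_at_derive1_snd V (F : V * R^o -> R^o) (u : V) : framed V ->
  smooth_at (u, 0) F ->
  smooth_at u (fun v => derive1 (fun t : R => F (v, t) : R) 0 : R^o).
Proof.
move=> frV sF.
rewrite (_ : (fun v => _) = 'D_((0, 1)) F \o (fun v => (v, 0))); last first.
  by apply/funext => v; rewrite derive1_snd.
apply: smooth_at_comp.
- by apply: framed_pair => //; exact: framed_real.
- exact: framed_real.
- by apply: smooth_at_pair; [exact: smooth_at_id|exact: smooth_at_cst].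
- exact: smooth_at_derive.
Qed.

(** The differential of h at 0 is additive and (1, 1) = (1, 0) + (0, 1). *)
Lemma is_derive_diag (h : R^o * R^o -> R^o) : smooth_at (0, 0) h ->
  is_derive (0 : R) (1 : R) (fun s : R => h (s, s) : R)
    (derive1 (fun s : R => h (s, 0) : R) 0 + derive1 (fun s : R => h (0, s) : R) 0).
Proof.
move=> /smooth_at_differentiable dh.
rewrite derive1_snd derive1_fst.
have E s : (0, 0) + s *: (1, 1) = (s, s) :> R^o * R^o.
  by rewrite [LHS]surjective_pairing /= add0r /GRing.scale /= mulr1.
have := @is_derive_line R _ h (0, 0) (1, 1) 0.
rewrite (_ : (fun s : R => h (_ + _)) = (fun s => h (s, s))); last first.
  by apply/funext => s; rewrite E.
rewrite E => /(_ dh); rewrite !deriveE // -linearD /=.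
by rewrite (_ : (1, 0) + (0, 1) = (1, 1)) // [LHS]surjective_pairing /= addr0 add0r.
Qed.

Lemma derive1_comm (k : R^o * R^o -> R^o) : smooth_at (0, 0) k ->
  derive1 (fun s : R => derive1 (fun t : R => k (s, t) : R) 0) 0 =
  derive1 (fun t : R => derive1 (fun s : R => k (s, t) : R) 0) 0.
Proof.
move=> sk.
under [X in derive1 X]eq_fun do rewrite derive1_snd.
under [X in _ = derive1 X _]eq_fun do rewrite derive1_fst.
by rewrite (derive1_fst ('D_((0, 1)) k)) (derive1_snd ('D_((1, 0)) k)) derive_comm.
Qed.

End Partials.

Section LinearAlgebra.
Context {F : fieldType} {d : nat} (P : 'rV[F]_d -> Prop).

(** Take a matrix of maximal rank among those with rows in P.  Its row space
    contains every vector of P, so its cokernel annihilates P, hence is zero. *)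
Lemma separating_subspace_full :
  P 0 -> (forall a u v, P u -> P v -> P (a *: u + v)) ->
  (forall w : 'cV[F]_d, (forall v, P v -> v *m w = 0) -> w = 0) ->
  forall v, P v.
Proof.
move=> P0 PL sep.
pose Q k := `[< exists m (A : 'M[F]_(m, d)), (forall i, P (row i A)) /\ \rank A = k >].
have exQ : exists k, Q k.
  exists 0%N; apply/asboolP; exists 0%N, 0; split; last by rewrite mxrank0.
  by case.
have ubQ k : Q k -> (k <= d)%N.
  by move=> /asboolP[m [A [_ <-]]]; exact: rank_leq_col.
case: (ex_maxnP exQ ubQ) => k /asboolP[m [A [PA rA]]] maxk.
have PAc (c : 'rV_m) : P (c *m A).
  rewrite mulmx_sum_row; elim/big_rec: _ => [//|i x _ Px]; exact: PL.
have sub v : P v -> (v <= A)%MS.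
  move=> Pv; apply/negPn/negP => nvA.
  have : Q (\rank (col_mx A v)).
    apply/asboolP; exists (m + 1)%N, (col_mx A v); split=> // i.
    case: (split_ordP i) => j ->; first by rewrite rowKu.
    by rewrite rowKd row_id.
  move=> /maxk; rewrite -rA leqNgt => /negP; apply.
  apply: rank_ltmx; rewrite ltmxE col_mx_sub (negPf nvA) andbF andbT.
  by rewrite -addsmxE addsmxSl.
have Afull : row_full A.
  rewrite -sub1mx submxE mul1mx; apply/eqP/matrixP => i j.
  have /matrixP/(_ i 0) : col j (cokermx A) = 0; last by rewrite !mxE.
  apply: sep => v /sub; rewrite submxE => /eqP vA.
  by rewrite colE mulmxA vA mul0mx.
by move=> v; have /submxP[c ->] := submx_full v Afull; exact: PAc.
Qed.
End LinearAlgebra.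

Lemma gcoord_basis (R : realType) (g : vectType R) i j :
  gcoord i (tnth gbasis j : g) = (i == j)%:R.
Proof.
rewrite /gcoord lfunE /= (tnth_nth 0) coord_free //.
  by rewrite eq_sym.
exact: basis_free (vbasisP _).
Qed.

Section LieAlgebra.
Context {R : realType} {g : vectType R} {n : nat} {G : lieGroupType R n}.
Context {br : g -> g -> g} (theta : g -> (G -> R) -> R).
Hypothesis gG : is_lie_algebra_of br theta.
Local Notation smoothG := (smooth_fun (@atlas R n G)).
Local Notation curve y := (forall t : R^o, smooth_into t (y : R^o -> G)).

Definition has_velocity (y : R -> G) (X : g) :=
  [/\ curve y, y 0 = 1%g &
      forall f, smoothG f -> theta X f = derive1 (f \o y) 0].

Lemma exists_curve X : exists y, has_velocity y X.
Proof.
have [y [/smooth_curveP sy y0 Xy]] := theta_tangent gG X.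
by exists y.
Qed.

Lemma exists_velocity (y : R -> G) : curve y -> y 0 = 1%g ->
  exists X, has_velocity y X.
Proof.
move=> sy y0; have tD : tangent_at (1%g : G) (fun f => derive1 (f \o y) 0).
  by exists y; split=> //; apply/smooth_curveP.
by have [X XD] := theta_surj gG tD; exists X; split=> // f /XD.
Qed.

Lemma smooth_curve_differentiable (y : R -> G) f (t : R^o) : curve y -> smoothG f ->
  differentiable (f \o y : R^o -> R^o) t.
Proof. by move=> sy sf; apply: smooth_at_differentiable; exact: smooth_fun_into. Qed.

Lemma theta_linear_fun X a f f' : smoothG f -> smoothG f' ->
  theta X (fun x => a * f x + f' x) = a * theta X f + theta X f'.
Proof.
move=> sf sf'; have [y [sy y0 Xy]] := exists_curve X.
have s1 := smooth_fun_linear (@atlas_open R n G) a sf sf'.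
rewrite (Xy _ s1) (Xy _ sf) (Xy _ sf') !derive1E.
exact: (derive_lincomb a (1 : R^o) (smooth_curve_differentiable 0 sy sf)
  (smooth_curve_differentiable 0 sy sf')).
Qed.

Lemma theta_leibniz X f f' : smoothG f -> smoothG f' ->
  theta X (fun x => f x * f' x) = f 1%g * theta X f' + theta X f * f' 1%g.
Proof.
move=> sf sf'; have [y [sy y0 Xy]] := exists_curve X.
have s1 := smooth_fun_mul (@atlas_open R n G) sf sf'.
rewrite (Xy _ s1) (Xy _ sf) (Xy _ sf') !derive1E -y0.
exact: (derive_mulf (1 : R^o) (smooth_curve_differentiable 0 sy sf)
  (smooth_curve_differentiable 0 sy sf')).
Qed.

(** Injectivity of theta says that the differentials at 1 of the globally
    defined smooth functions separate the points of g, and a subspace of the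
    dual of g that separates points is the whole dual.  Thus covectors are
    extended to smooth functions without cutting off by bump functions. *)
Lemma cotangent_onto (phi : dual g) :
  exists2 f, smoothG f & forall X, theta X f = phi X.
Proof.
pose d := \dim (fullv : {vspace g}).
pose P (v : 'rV[R]_d) := exists2 f, smoothG f &
  forall i, theta (tnth gbasis i) f = v 0 i.
have thetaE X f : smoothG f ->
    theta X f = \sum_i gcoord i X * theta (tnth gbasis i) f.
  move=> sf; rewrite [in LHS](gbasis_sum X).
  have theta0 : theta 0 f = 0.
    have := theta_linear gG (-1) 0 0 sf.
    by rewrite scaler0 addr0 mulN1r addNr.
  by elim/big_rec2: _ => [//|i u v _ <-]; rewrite (theta_linear gG).
have s0 : smoothG (fun=> 0) by exact: smooth_fun_cst.
have := @separating_subspace_full _ d P _ _ _ (\row_i phi (tnth gbasis i)).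
case.
- exists (fun=> 0) => // i; rewrite mxE.
  have [y [_ _ ->]] := exists_curve (tnth gbasis i) => //.
  exact: derive1_cst.
- move=> a u v [f sf fu] [k sk kv]; exists (fun x => a * f x + k x).
    exact: (smooth_fun_linear (@atlas_open R n G)).
  by move=> i; rewrite theta_linear_fun // fu kv !mxE.
- move=> w sep; pose X := \sum_i w i 0 *: tnth gbasis i.
  have gX i : gcoord i X = w i 0.
    rewrite linear_sum /= (bigD1 i) //= big1 => [|j ji].
      by rewrite linearZ /= gcoord_basis eqxx addr0; exact: mulr1.
    by rewrite linearZ /= gcoord_basis eq_sym (negPf ji); exact: mulr0.
  have X0 : X = 0.
    apply: (theta_inj gG) => f sf; rewrite !thetaE //.
    have /matrixP/(_ 0 0) : \row_i theta (tnth gbasis i) f *m w = 0.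
      by apply: sep; exists f => // i; rewrite mxE.
    rewrite !mxE => S0.
    rewrite [RHS]big1; last by move=> i _; rewrite linear0 mul0r.
    rewrite -[RHS]S0; apply: eq_bigr => i _; rewrite gX mxE mulrC //.
  by apply/matrixP => i j; rewrite ord1 -gX X0 linear0 mxE.
- move=> f sf fphi; exists f => // X; rewrite thetaE //.
  rewrite [in RHS](gbasis_sum X) linear_sum /=; apply: eq_bigr => i _.
  by rewrite linearZ /= fphi mxE.
Qed.

(** The conjugate by y of a curve with velocity X is a curve through 1, and its
    velocity is a point of g because theta is surjective. *)
Lemma AdE y X f : smoothG f ->
  theta (Ad theta y X) f = theta X (fun x => f (y * x * y^-1)%g).
Proof.
move=> sf; rewrite /Ad; case: xgetP => [Z _ /(_ f sf) //|].
have [z [sz z0 Xz]] := exists_curve X.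
have sw : curve (fun t => y * z t * y^-1)%g.
  move=> t; apply: smooth_into_mul; last exact: smooth_into_cst.
  by apply: smooth_into_mul; [exact: smooth_into_cst|].
have w0 : (y * z 0 * y^-1)%g = 1%g by rewrite z0 mulg1 mulgV.
have [Z [_ _ ZE]] := exists_velocity sw w0.
case/(_ Z) => k sk; rewrite ZE // Xz //; exact: smooth_fun_translate.
Qed.

Lemma Ad_linear y a X Y : Ad theta y (a *: X + Y) = a *: Ad theta y X + Ad theta y Y.
Proof.
apply: (theta_inj gG) => f sf; rewrite (theta_linear gG) // !AdE //.
by rewrite (theta_linear gG) //; exact: smooth_fun_translate.
Qed.

Lemma Ad1 X : Ad theta 1%g X = X.
Proof.
apply: (theta_inj gG) => f sf; rewrite AdE //; congr (theta X).
by apply/funext => x; rewrite invg1 mulg1 mul1g.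
Qed.

Lemma AdM y z X : Ad theta (y * z)%g X = Ad theta y (Ad theta z X).
Proof.
apply: (theta_inj gG) => f sf; rewrite !AdE //; last exact: smooth_fun_translate.
by congr (theta X); apply/funext => x; rewrite invgM !mulgA.
Qed.

(** theta X is a derivative with respect to the time of a curve z, taken as one
    more variable of a smooth function. *)
Lemma smooth_theta (V : normedModType R) (x : V) (F : V -> G -> R) X : framed V ->
  (forall z, curve z -> smooth_at (x, 0) (fun p : V * R^o => F p.1 (z p.2) : R^o)) ->
  (forall u, smoothG (F u)) ->
  smooth_at x (fun u => theta X (F u) : R^o).
Proof.
move=> frV sF sFu; have [z [sz z0 Xz]] := exists_curve X.
have := smooth_at_derive1_snd frV (sF _ sz); congr (smooth_at x _).
by apply/funext => u; rewrite Xz.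
Qed.

Lemma smooth_fun_ltranslate (x : G) (f : G -> R) :
  smoothG f -> smoothG (fun y => f (x * y)%g).
Proof.
move=> /(smooth_fun_translate x 1%g); congr smooth_fun.
by apply/funext => z; rewrite mulg1.
Qed.

Lemma smooth_left_field X f : smoothG f -> smoothG (left_field theta X f).
Proof.
move=> sf; apply/smooth_funP => c u Ac Ru.
apply: (smooth_theta (F := fun u z => f (cinv c u * z)%g)) => [|z sz|v].
- exact: framed_rV.
- apply: (smooth_fun_into (y := fun p : 'rV[R]_n * R^o => cinv c p.1 * z p.2)%g) => //.
  apply: smooth_into_mul.
    apply: (smooth_into_comp (g := fst)); [exact: framed_rV|exact: smooth_at_fst|].
    exact: smooth_into_chart.
  by apply: (smooth_into_comp (g := snd)); [exact: framed_real|exact: smooth_at_snd|].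
- exact: smooth_fun_ltranslate.
Qed.

(** f (x * y(s) * y(s)^-1) does not depend on s, and its derivative at 0 is the
    sum of the contributions of the two occurrences of s. *)
Lemma derive1_inv_curve (y : R -> G) X f x : has_velocity y X -> smoothG f ->
  derive1 (fun s => f (x * (y s)^-1)%g) 0 = - left_field theta X f x.
Proof.
move=> [sy y0 Xy] sf.
pose q (p : R^o * R^o) : R^o := f (x * y p.1 * (y p.2)^-1)%g.
have sq : smooth_at (0, 0) q.
  apply: (smooth_fun_into (y := fun p : R^o * R^o => x * y p.1 * (y p.2)^-1)%g) => //.
  apply: smooth_into_mul.
    apply: smooth_into_mul; first exact: smooth_into_cst.
    by apply: (smooth_into_comp (g := fst)) => //; [exact: framed_real|exact: smooth_at_fst].
  apply: smooth_into_inv.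
  by apply: (smooth_into_comp (g := snd)) => //; [exact: framed_real|exact: smooth_at_snd].
have := is_derive_diag sq.
rewrite (_ : (fun s : R => q (s, s)) = fun=> f x); last first.
  by apply/funext => s; rewrite /q /= -mulgA mulgV mulg1.
move=> /@derive_val; rewrite derive_cst => /esym/eqP; rewrite addrC addr_eq0 => /eqP.
rewrite /q /= y0 mulg1 => ->; congr (- _).
rewrite /left_field Xy; last exact: smooth_fun_ltranslate.
by congr (derive1 _ 0); apply/funext => s; rewrite invg1 mulg1.
Qed.

Lemma theta_opp X f : smoothG f -> theta X (fun x => - f x) = - theta X f.
Proof.
move=> sf; have s0 : smoothG (fun=> 0) by exact: smooth_fun_cst.
have theta0 : theta X (fun=> 0) = 0.
  have [y [_ _ ->]] := exists_curve X => //.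
  exact: derive1_cst.
have := theta_linear_fun X (-1) sf s0; rewrite theta0 addr0 mulN1r => <-.
by congr (theta X); apply/funext => x; rewrite mulN1r addr0.
Qed.

(** The derivative of Ad at 1 is ad.  Let z have velocity Z.  The first of the
    two occurrences of s in f (y(s) * z(t) * y(s)^-1) contributes X Z f.  For
    the second, the derivatives in s and t are exchanged and
    [derive1_inv_curve] gives - Z X f. *)
Lemma is_derive_Ad (y : R -> G) X Z f : has_velocity y X -> smoothG f ->
  is_derive (0 : R) (1 : R) (fun s => theta (Ad theta (y s) Z) f) (theta (br X Z) f).
Proof.
move=> vX sf; have [sy y0 Xy] := vX; have [z [sz z0 Zz]] := exists_curve Z.
have fR : framed (R^o : normedModType R) := framed_real.
have fRR : framed (R^o * R^o : normedModType R)%type := framed_pair fR fR.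
pose h (p : R^o * R^o) : R^o := theta Z (fun x => f (y p.1 * x * (y p.2)^-1)%g).
have sh : smooth_at (0, 0) h.
  apply: (smooth_theta (F := fun p x => f (y p.1 * x * (y p.2)^-1)%g)) => [//|w sw|p].
    apply: (smooth_fun_into (y := fun p : (R^o * R^o) * R^o =>
      y p.1.1 * w p.2 * (y p.1.2)^-1)%g) => //.
    have s1 : smooth_at (0, 0, 0 : R^o) (fun p : (R^o * R^o) * R^o => p.1.1).
      apply: (smooth_at_comp (g := fst) (f := fst)) => //; first exact: smooth_at_fst.
      exact: smooth_at_fst.
    have s2 : smooth_at (0, 0, 0 : R^o) (fun p : (R^o * R^o) * R^o => p.1.2).
      apply: (smooth_at_comp (g := fst) (f := snd)) => //; first exact: smooth_at_fst.
      exact: smooth_at_snd.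
    apply: smooth_into_mul; first apply: smooth_into_mul.
    - exact: (smooth_into_comp fR s1 (sy _)).
    - by apply: (smooth_into_comp (g := snd)) => //; exact: smooth_at_snd.
    - exact: smooth_into_inv (smooth_into_comp fR s2 (sy _)).
  exact: smooth_fun_translate.
have := is_derive_diag sh.
have -> : (fun s : R => h (s, s)) = (fun s => theta (Ad theta (y s) Z) f).
  by apply/funext => s; rewrite AdE.
congr is_derive; rewrite (theta_bracket gG) //; congr (_ + _).
  rewrite Xy; last exact: smooth_left_field.
  congr (derive1 _ 0); apply/funext => s; rewrite /h /left_field /= y0.
  by congr (theta Z); apply/funext => x; rewrite invg1 mulg1.
pose k (p : R^o * R^o) : R^o := f (z p.2 * (y p.1)^-1)%g.
have sk : smooth_at (0, 0) k.
  apply: (smooth_fun_into (y := fun p : R^o * R^o => z p.2 * (y p.1)^-1)%g) => //.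
  apply: smooth_into_mul; last apply: smooth_into_inv.
    by apply: (smooth_into_comp (g := snd)) => //; exact: smooth_at_snd.
  by apply: (smooth_into_comp (g := fst)) => //; exact: smooth_at_fst.
have -> : (fun s : R => h (0, s)) = (fun s => derive1 (fun t : R => k (s, t) : R) 0).
  apply/funext => s; rewrite /h /= Zz; last exact: smooth_fun_translate.
  by congr (derive1 _ 0); apply/funext => t; rewrite /k /= y0 mul1g.
rewrite (derive1_comm sk) -theta_opp; last exact: smooth_left_field.
rewrite Zz; last exact/(smooth_fun_opp (@atlas_open R n G))/smooth_left_field.
congr (derive1 _ 0); apply/funext => t; rewrite /k /=.
exact: derive1_inv_curve.
Qed.

Lemma is_derive_Ad_linear (y : R -> G) X Z (phi : dual g) : has_velocity y X ->
  is_derive (0 : R) (1 : R) (fun s => phi (Ad theta (y s) Z) : R) (phi (br X Z)).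
Proof.
move=> vX; have [f sf fphi] := cotangent_onto phi.
have := is_derive_Ad Z vX sf; rewrite fphi; congr is_derive.
by apply/funext => s; rewrite fphi.
Qed.

End LieAlgebra.


(** * Coordinates on the dual of a subalgebra *)

Section DualChart.
Context {R : realType} {g : vectType R} {h : {vspace g}} {l : nat}.
Context {b : l.-tuple g}.
Hypothesis bh : basis_of h b.
Local Notation hdual := (dual (subvs_of h)).
Implicit Types (lambda : hdual) (F : hdual -> R).

Lemma mem_basis_tuple i : tnth b i \in h.
Proof. by rewrite (basis_mem bh) // mem_tnth. Qed.

Lemma pairing_linear lambda a X Y :
  pairing lambda (a *: X + Y) = a * pairing lambda X + pairing lambda Y.
Proof. by rewrite /pairing !linearP. Qed.

Lemma pairing_expand lambda X : X \in h ->
  pairing lambda X = \sum_i coord b i X * pairing lambda (tnth b i).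
Proof.
move=> Xh; rewrite {1}(coord_basis bh Xh) /pairing !linear_sum /=.
by apply: eq_bigr => i _; rewrite !linearZ /= (tnth_nth 0).
Qed.

Lemma dual_basisE i X : dual_basis h b i X = coord b i (vsval X).
Proof. by rewrite /dual_basis lfunE. Qed.

Lemma dual_cmapK : cancel (cmap (dual_chart h b)) (cinv (dual_chart h b)).
Proof.
move=> lambda; apply/lfunP => X; rewrite /= sum_lfunE.
have -> : lambda X = pairing lambda (vsval X) by rewrite /pairing vsvalK.
rewrite pairing_expand ?subvsP //; apply: eq_bigr => i _.
by rewrite scale_lfunE dual_basisE mxE mulrC.
Qed.

Lemma dual_cinvK : cancel (cinv (dual_chart h b)) (cmap (dual_chart h b)).
Proof.
move=> u; apply/rowP => i; rewrite mxE /= /pairing sum_lfunE (bigD1 i) //= big1.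
  rewrite addr0 scale_lfunE dual_basisE vsprojK ?mem_basis_tuple //.
  rewrite (tnth_nth 0) coord_free ?(basis_free bh) // eqxx; exact: mulr1.
move=> j ji; rewrite scale_lfunE dual_basisE vsprojK ?mem_basis_tuple //.
by rewrite (tnth_nth 0) coord_free ?(basis_free bh) // eq_sym (negPf ji); exact: mulr0.
Qed.

Lemma dual_crange : crange (dual_chart h b) = setT.
Proof.
apply/seteqP; split=> // u _; exists (cinv (dual_chart h b) u) => //.
exact: dual_cinvK.
Qed.

Lemma dual_cinv_shift u i (t : R) :
  cinv (dual_chart h b) (u + t *: delta_mx 0 i) =
  cinv (dual_chart h b) u + t *: dual_basis h b i.
Proof.
rewrite /=; under eq_bigr do rewrite !mxE scalerDl.
rewrite big_split /=; congr (_ + _).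
rewrite (bigD1 i) //= big1 => [|j ji]; first by rewrite !eqxx mulr1 addr0.
by rewrite (negPf ji) mulr0 scale0r.
Qed.

Lemma dual_partialE i F lambda :
  dual_partial b i F lambda =
  'D_(delta_mx 0 i) (F \o cinv (dual_chart h b) : _ -> R^o) (cmap (dual_chart h b) lambda).
Proof.
rewrite -derive1_line /dual_partial; congr (derive1 _ 0); apply/funext => t.
by rewrite /comp dual_cinv_shift dual_cmapK.
Qed.

Lemma smooth_fun_dualP F : smooth_fun [set dual_chart h b] F <->
  forall u, smooth_at u (F \o cinv (dual_chart h b) : _ -> R^o).
Proof.
split=> [sF u|sF _ ->].
  by exists setT; split; [exact: openT| |rewrite -dual_crange; exact: sF].
rewrite dual_crange; apply/smooth_onP => //; exact: openT.
Qed.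

(** Chain rule along a curve in the dual of h, a space whose smooth structure
    is only given through the coordinates. *)
Lemma is_derive_dual (mu : R -> hdual) F (dmu : 'I_l -> R) :
  smooth_fun [set dual_chart h b] F ->
  (forall i, is_derive (0 : R) (1 : R) (fun s => pairing (mu s) (tnth b i)) (dmu i)) ->
  is_derive (0 : R) (1 : R) (F \o mu) (\sum_i dmu i * dual_partial b i F (mu 0)).
Proof.
move=> /smooth_fun_dualP sF dm.
pose u (s : R) : 'rV[R]_l := cmap (dual_chart h b) (mu s).
have ui i : (fun s => u s 0 i) = (fun s => pairing (mu s) (tnth b i)).
  by apply/funext => s; rewrite mxE.
have du : derivable u 0 1.
  by apply/derivable_mxP => i j; rewrite ord1 ui; have [] := dm j.
have dF := smooth_at_differentiable (sF (u 0)).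
have dfu : differentiable u (0 : R) by apply/derivable1_diffP.
rewrite (_ : F \o mu = (F \o cinv (dual_chart h b)) \o u); last first.
  by apply/funext => s; rewrite /u /comp dual_cmapK.
have dFu : differentiable ((F \o cinv (dual_chart h b) : _ -> R^o) \o u) (0 : R).
  exact: differentiable_comp.
split; first exact: diff_derivable.
rewrite deriveE // diff_comp //= -(deriveE _ dfu) derive_mx //.
rewrite [X in 'd _ _ X]row_sum_delta linear_sum /=.
apply: eq_bigr => i _; rewrite linearZ /= !mxE ui -deriveE // -dual_partialE.
by have [_ ->] := dm i.
Qed.

Lemma dual_partial_linear i a F F' lambda :
  smooth_fun [set dual_chart h b] F -> smooth_fun [set dual_chart h b] F' ->
  dual_partial b i (fun mu => a * F mu + F' mu) lambda =
  a * dual_partial b i F lambda + dual_partial b i F' lambda.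
Proof.
move=> /smooth_fun_dualP sF /smooth_fun_dualP sF'; rewrite !dual_partialE.
by apply: derive_lincomb; exact: smooth_at_differentiable.
Qed.

Lemma dual_partial_mul i F F' lambda :
  smooth_fun [set dual_chart h b] F -> smooth_fun [set dual_chart h b] F' ->
  dual_partial b i (fun mu => F mu * F' mu) lambda =
  F lambda * dual_partial b i F' lambda + dual_partial b i F lambda * F' lambda.
Proof.
move=> /smooth_fun_dualP sF /smooth_fun_dualP sF'; rewrite !dual_partialE.
set x := cmap _ lambda.
have xE (K : hdual -> R) : K lambda = (K \o cinv (dual_chart h b)) x by rewrite /x /comp dual_cmapK.
rewrite (xE F) (xE F').
by apply: derive_mulf; exact: smooth_at_differentiable.
Qed.

Lemma dual_open (c : chart hdual 'rV[R]_l) :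
  [set dual_chart h b] c -> open (crange c).
Proof. by move=> ->; rewrite dual_crange; exact: openT. Qed.

Lemma dual_partial_sum i I (s : seq I) (F : I -> hdual -> R) (a : I -> R) lambda :
  (forall j, smooth_fun [set dual_chart h b] (F j)) ->
  dual_partial b i (fun mu => \sum_(j <- s) a j * F j mu) lambda =
  \sum_(j <- s) a j * dual_partial b i (F j) lambda.
Proof.
move=> sF; elim: s => [|j s IH].
  rewrite big_nil (_ : (fun mu => _) = fun=> 0); first exact: derive1_cst.
  by apply/funext => mu; rewrite big_nil.
rewrite big_cons -IH -dual_partial_linear //.
  by congr (dual_partial _ i _ _); apply/funext => mu; rewrite big_cons.
apply: (smooth_fun_sum dual_open) => k.
exact/(smooth_fun_mul dual_open)/sF/(smooth_fun_cst (a k)).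
Qed.

Lemma covector_expand (phi : dual g) :
  phi = \sum_i phi (tnth gbasis i) *: gcoord i.
Proof.
apply/lfunP => X; rewrite sum_lfunE [in LHS](gbasis_sum X) linear_sum /=.
by apply: eq_bigr => i _; rewrite linearZ scale_lfunE /=; exact: mulrC.
Qed.

Lemma bivector_expand (w : bivector g) (xi eta : dual g) :
  w xi eta = \sum_i \sum_j xi (tnth gbasis i) * eta (tnth gbasis j) *
    w (gcoord i) (gcoord j).
Proof.
have L0 (k : dual g) : w 0 k = 0.
  have := bivector_linearl w (-1) 0 0 k.
  by rewrite scaler0 addr0 mulN1r addNr.
have R0 (k : dual g) : w k 0 = 0.
  have := bivector_linearr w (-1) 0 0 k.
  by rewrite scaler0 addr0 mulN1r addNr.
rewrite [in LHS](covector_expand xi).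
elim/big_rec2: _ => [|i y1 y2 _ <-]; first by rewrite L0.
rewrite bivector_linearl; congr (_ + _).
rewrite [in LHS](covector_expand eta).
under [in RHS]eq_bigr do rewrite -mulrA.
rewrite -mulr_sumr; congr (_ * _).
elim/big_rec2: _ => [|j z1 z2 _ <-]; first by rewrite R0.
by rewrite bivector_linearr.
Qed.

Lemma dual_partial_bivector i (r : hdual -> bivector g) xi eta lambda :
  smooth_bivector_valued b r ->
  dual_partial b i (fun mu => r mu xi eta) lambda =
  \sum_j \sum_k xi (tnth gbasis j) * eta (tnth gbasis k) *
    dual_partial b i (fun mu => r mu (gcoord j) (gcoord k)) lambda.
Proof.
move=> sr; rewrite (_ : (fun mu => _) = fun mu =>
  \sum_j 1 * \sum_k xi (tnth gbasis j) * eta (tnth gbasis k) *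
    r mu (gcoord j) (gcoord k)).
  rewrite dual_partial_sum => [|j].
    by apply: eq_bigr => j _; rewrite mul1r dual_partial_sum // => k; exact: sr.
  apply: (smooth_fun_sum dual_open) => k.
  exact/(smooth_fun_mul dual_open)/sr/smooth_fun_cst.
apply/funext => mu; rewrite bivector_expand; apply: eq_bigr => j _.
by rewrite mul1r.
Qed.

End DualChart.


(** * Infinitesimal variation of r under the coadjoint and adjoint actions *)

Lemma linfun_linear (R : realType) (U V : vectType R) (f : U -> V) :
  linear f -> linfun f =1 f.
Proof.
move=> lin; pose fM := GRing.isLinear.Build _ _ _ _ _ lin.
pose fL : {linear U -> V} := HB.pack f fM.
exact: (lfunE fL).
Qed.

Lemma is_derive_bigsum (R : realType) N (F : 'I_N -> R -> R) (dF : 'I_N -> R) (x : R) :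
  (forall i, is_derive x (1 : R) (F i) (dF i)) ->
  is_derive x (1 : R) (fun s => \sum_i F i s) (\sum_i dF i).
Proof.
move=> D; rewrite (_ : (fun s => _) = \sum_i F i); first exact: is_derive_sum.
by apply/funext => s; rewrite fct_sumE.
Qed.

Lemma is_derive_mulf (R : realType) (f k : R -> R) (x df dk : R) :
  is_derive x (1 : R) f df -> is_derive x (1 : R) k dk ->
  is_derive x (1 : R) (fun s => f s * k s) (f x * dk + k x * df).
Proof. exact: is_deriveM. Qed.

Section Equivariance.
Context {R : realType} {g : vectType R} {h : {vspace g}} {n : nat} {G : lieGroupType R n}.
Context (br : g -> g -> g) (theta : g -> (G -> R) -> R) {l : nat} (b : l.-tuple g).
Hypothesis br_lie : lie_bracket br.
Hypothesis gG : is_lie_algebra_of br theta.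
Hypothesis bh : basis_of h b.
Local Notation hdual := (dual (subvs_of h)).
Local Notation smoothG := (smooth_fun (@atlas R n G)).
Context (r : hdual -> bivector g).
Hypothesis r_smooth : smooth_bivector_valued b r.
Implicit Types (lambda : hdual) (xi eta : dual g).

Definition coAdg (y : G) xi : dual g := linfun (fun X => xi (Ad theta y X)).

Definition coadg (X : g) xi : dual g := linfun (fun Z => xi (br X Z)).

Lemma coAdgE y xi X : coAdg y xi X = xi (Ad theta y X).
Proof.
by apply: linfun_linear => a X' Y; rewrite (Ad_linear gG) linearP.
Qed.

Lemma coadgE X xi Z : coadg X xi Z = xi (br X Z).
Proof.
by apply: linfun_linear => a X' Y; rewrite (br_linearr br_lie) linearP.
Qed.

Lemma coAdE y lambda X : X \in h ->
  pairing (coAd theta y lambda) X = pairing lambda (Ad theta y X).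
Proof.
move=> Xh; rewrite {1}/pairing /coAd linfun_linear ?vsprojK // => a Y Z.
by rewrite linearP (Ad_linear gG) pairing_linear.
Qed.

Lemma coAdgM y z xi : coAdg z (coAdg y xi) = coAdg (y * z)%g xi.
Proof. by apply/lfunP => X; rewrite !coAdgE (AdM gG). Qed.

Lemma coAdg1 xi : coAdg 1%g xi = xi.
Proof. by apply/lfunP => X; rewrite !coAdgE (Ad1 gG). Qed.

Lemma hdual_ext lambda mu :
  (forall X, X \in h -> pairing lambda X = pairing mu X) -> lambda = mu.
Proof.
move=> E; apply/lfunP => X; have := E (vsval X) (subvsP X).
by rewrite /pairing vsvalK.
Qed.

Lemma coAd1 lambda : coAd theta 1%g lambda = lambda.
Proof. by apply: hdual_ext => X Xh; rewrite coAdE // (Ad1 gG). Qed.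

Lemma coAdM y z lambda : (forall X, X \in h -> Ad theta z X \in h) ->
  coAd theta z (coAd theta y lambda) = coAd theta (y * z)%g lambda.
Proof.
by move=> zh; apply: hdual_ext => X Xh; rewrite !coAdE ?zh // (AdM gG).
Qed.

(** The derivative at y = 1, in the direction X, of
    r (lambda o Ad y) (xi o Ad y, eta o Ad y); see [is_derive_transport]. *)
Definition infinitesimal_variation (X : g) lambda xi eta : R :=
  \sum_i pairing lambda (br X (tnth b i)) *
    dual_partial b i (fun mu => r mu xi eta) lambda
  + r lambda (coadg X xi) eta + r lambda xi (coadg X eta).

(** Product rule, after expanding r in a basis of g so that only scalar
    functions have to be differentiated. *)
Lemma is_derive_transport (y : R -> G) X lambda xi eta : has_velocity theta y X ->
  is_derive (0 : R) (1 : R)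
    (fun s => r (coAd theta (y s) lambda) (coAdg (y s) xi) (coAdg (y s) eta))
    (infinitesimal_variation X lambda xi eta).
Proof.
move=> vX; have y0 : y 0 = 1%g by case: vX.
pose mu s := coAd theta (y s) lambda.
have mu0 : mu 0 = lambda by rewrite /mu y0 coAd1.
have dmu i : is_derive (0 : R) (1 : R) (fun s => pairing (mu s) (tnth b i))
    (pairing lambda (br X (tnth b i))).
  pose phi : dual g := linfun (fun X => pairing lambda X : R^o).
  have phiE Z : phi Z = pairing lambda Z.
    by apply: linfun_linear => a Y Y'; rewrite pairing_linear.
  have := is_derive_Ad_linear gG (tnth b i) phi vX; rewrite phiE; congr is_derive.
  by apply/funext => s; rewrite phiE coAdE // (mem_basis_tuple bh).
have := @is_derive_bigsum R _ (fun j s => \sum_k xi (Ad theta (y s) (tnth gbasis j)) *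
  (eta (Ad theta (y s) (tnth gbasis k)) * r (mu s) (gcoord j) (gcoord k))).
pose d j k := \sum_i pairing lambda (br X (tnth b i)) *
   dual_partial b i (fun mu => r mu (gcoord j) (gcoord k)) lambda.
pose e (j : 'I_(\dim (fullv : {vspace g}))) : g := tnth gbasis j.
pose D j := \sum_k (xi (e j) * (eta (e k) * d j k + r lambda (gcoord j) (gcoord k) * eta (br X (e k)))
  + (eta (e k) * r lambda (gcoord j) (gcoord k)) * xi (br X (e j))).
move=> /(_ D 0) Der.
have -> : (fun s => r (coAd theta (y s) lambda) (coAdg (y s) xi) (coAdg (y s) eta)) =
  (fun s => \sum_j \sum_k xi (Ad theta (y s) (tnth gbasis j)) *
    (eta (Ad theta (y s) (tnth gbasis k)) * r (mu s) (gcoord j) (gcoord k))).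
  apply/funext => s; rewrite bivector_expand; apply: eq_bigr => j _.
  by apply: eq_bigr => k _; rewrite !coAdgE mulrA.
have -> : infinitesimal_variation X lambda xi eta = \sum_j D j.
  rewrite /infinitesimal_variation.
  under eq_bigr do rewrite (dual_partial_bivector bh _ _ _ _ r_smooth).
  rewrite !(bivector_expand (r lambda)).
  have -> : \sum_i pairing lambda (br X (tnth b i)) *
     (\sum_j \sum_k xi (tnth gbasis j) * eta (tnth gbasis k) *
       dual_partial b i (fun mu => r mu (gcoord j) (gcoord k)) lambda) =
     \sum_j \sum_k xi (e j) * eta (e k) * d j k.
    under eq_bigr do rewrite mulr_sumr; rewrite exchange_big; apply: eq_bigr => j _.
    under eq_bigr do rewrite mulr_sumr; rewrite exchange_big; apply: eq_bigr => k _.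
    by rewrite /d mulr_sumr; apply: eq_bigr => i _ /=; ring.
  rewrite -!big_split; apply: eq_bigr => j _.
  rewrite /= -!big_split; apply: eq_bigr => k _ /=.
  by rewrite !coadgE /e; ring.
apply: Der => j; apply: is_derive_bigsum => k.
have d1 := is_derive_Ad_linear gG (e j) xi vX.
have d2 := is_derive_Ad_linear gG (e k) eta vX.
have d3 : is_derive (0 : R) (1 : R) (fun s => r (mu s) (gcoord j) (gcoord k)) (d j k).
  by have := is_derive_dual bh (r_smooth (gcoord j) (gcoord k)) dmu; rewrite mu0.
have := is_derive_mulf d1 (is_derive_mulf d2 d3).
by rewrite !y0 !(Ad1 gG) mu0.
Qed.

End Equivariance.


(** * Equivariance under a connected subgroup *)

(** The bounded smooth function sin will reparametrize a segment by the whole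
    real line, since curves in H are defined for all times. *)
Lemma smooth_at_sin (R : realType) (t : R^o) : smooth_at t (@sin R : R^o -> R^o).
Proof.
(* sin and cos are each other's derivatives up to sign, so the induction on the
   order is on all their combinations *)
suff C k (a b : R) : C_k k setT (fun t : R^o => a * sin t + b * cos t : R^o).
  exists setT; split=> // [|k]; first exact: openT.
  have := C k 1 0; congr (C_k _ _ _).
  by apply/funext => s; rewrite mul1r mul0r addr0.
have D (a' b' : R) (s : R) : is_derive s (1 : R) (fun t : R => a' * sin t + b' * cos t)
    (a' * cos s - b' * sin s).
  have := is_deriveD (is_deriveZ a' (is_derive_sin s)) (is_deriveZ b' (is_derive_cos s)).
  by congr is_derive; rewrite /GRing.scale /= mulrN.
elim: k a b => [|k IH] a b.
  move=> s _; apply: (@differentiable_continuous R R^o R^o).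
  by apply/derivable1_diffP; have [] := D a b s.
rewrite C_kSE; split=> [s _|v].
  by apply/derivable1_diffP; have [] := D a b s.
have := IH (v * - b) (v * a); congr (C_k _ _ _); apply/funext => s.
have [d Dd] := D a b s.
have ds : differentiable (fun t : R^o => a * sin t + b * cos t : R^o) s.
  exact/derivable1_diffP.
rewrite deriveE // -[X in 'd _ _ X](mulr1 (v : R)) [RHS]linearZ /= -deriveE //.
by rewrite Dd /GRing.scale /=; ring.
Qed.

Lemma is_derive_translate (R : realType) (f : R -> R) (t df : R) :
  is_derive (0 : R) (1 : R) (fun s => f (t + s)) df -> is_derive t (1 : R) f df.
Proof.
have E : (fun d : R => d^-1 *: (f (t + (d *: (1 : R) + 0)) - f (t + 0)))
  = (fun d => d^-1 *: (f (d *: (1 : R) + t) - f t)).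
  by apply/funext => d; rewrite !addr0 [t + _]addrC.
by case=> + <-; rewrite /derivable /derive E.
Qed.

Section Subgroup.
Context {R : realType} {g : vectType R} {h : {vspace g}} {n : nat} {G : lieGroupType R n}.
Context (br : g -> g -> g) (theta : g -> (G -> R) -> R) {l : nat} (b : l.-tuple g).
Context {m : nat} {H : lieGroupType R m} (iota : H -> G).
Hypothesis br_lie : lie_bracket br.
Hypothesis gG : is_lie_algebra_of br theta.
Hypothesis H_sub : is_connected_lie_subgroup theta h iota.
Hypothesis bh : basis_of h b.
Local Notation hdual := (dual (subvs_of h)).
Local Notation smoothG := (smooth_fun (@atlas R n G)).
Local Notation curve y := (forall t : R^o, smooth_into t (y : R^o -> H)).
Context (r : hdual -> bivector g).
Hypothesis r_smooth : smooth_bivector_valued b r.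
Implicit Types (lambda : hdual) (xi eta : dual g).

Lemma iota1 : iota 1%g = 1%g.
Proof.
apply: (@mulgI _ (iota 1%g)).
by rewrite -(iota_morph H_sub) !mulg1.
Qed.

Lemma iotaV y : iota (y^-1)%g = (iota y)^-1%g.
Proof.
apply: (@mulgI _ (iota y)).
by rewrite -(iota_morph H_sub) !mulgV iota1.
Qed.

Lemma subgroup_velocity (z : R -> H) : curve z -> z 0 = 1%g ->
  exists2 X, X \in h & has_velocity theta (iota \o z) X.
Proof.
move=> sz z0.
have sy (t : R^o) : smooth_into t (iota \o z : R^o -> G).
  exact: smooth_map_into (iota_smooth H_sub) (sz t).
have [|X vX] := exists_velocity gG sy; first by rewrite /= z0 iota1.
exists X => //; apply/(subgroup_lie_algebra H_sub).
exists (fun f => derive1 (f \o z) 0); first by exists z; split=> //; apply/smooth_curveP.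
by move=> f sf; case: vX => _ _ ->.
Qed.

Lemma subgroup_curve X : X \in h -> exists z : R -> H,
  [/\ curve z, z 0 = 1%g & has_velocity theta (iota \o z) X].
Proof.
move=> /(subgroup_lie_algebra H_sub)[D [z [/smooth_curveP sz z0 Dz]] XD].
exists z; split=> //; split=> [t||f sf].
- exact: smooth_map_into (iota_smooth H_sub) (sz t).
- by rewrite /= z0 iota1.
- rewrite XD // Dz //.
  exact: smooth_fun_comp (iota_smooth H_sub) sf.
Qed.

(** For y in H, conjugation by y keeps the curves of H in H. *)
Lemma Ad_subalgebra y X : X \in h -> Ad theta (iota y) X \in h.
Proof.
move=> /subgroup_curve[z [sz z0 [_ _ Xz]]].
have sw : curve (fun t => y * z t * y^-1)%g.
  move=> t; apply: smooth_into_mul; last exact: smooth_into_cst.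
  by apply: smooth_into_mul; [exact: smooth_into_cst|].
have w0 : (y * z 0 * y^-1)%g = 1%g by rewrite z0 mulg1 mulgV.
have [Z Zh [_ _ Zw]] := subgroup_velocity sw w0.
suff -> : Ad theta (iota y) X = Z by [].
apply: (theta_inj gG) => f sf; rewrite (AdE gG) // Xz; last exact: smooth_fun_translate.
rewrite Zw //; congr (derive1 _ 0); apply/funext => t.
by rewrite /comp !(iota_morph H_sub) iotaV.
Qed.

(** Equivariance under y, with both sides transported by y so that it becomes
    the stability of r under an action. *)
Definition invariant_under (y : H) := forall lambda xi eta,
  r (coAd theta (iota y) lambda) (coAdg theta (iota y) xi) (coAdg theta (iota y) eta) =
  r lambda xi eta.

Lemma equivariant_invariant :
  (forall y lambda xi eta, r (coAd theta (iota y)^-1%g lambda) xi eta =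
     Ad_bivector theta (iota y) (r lambda) xi eta) <->
  forall y, invariant_under y.
Proof.
split=> [E y lambda xi eta|E y lambda xi eta].
  have := E (y^-1)%g lambda (coAdg theta (iota y) xi) (coAdg theta (iota y) eta).
  rewrite iotaV invgK => ->; rewrite /Ad_bivector -!/(coAdg _ _ _).
  by rewrite !(coAdgM gG) mulgV !(coAdg1 gG).
rewrite /Ad_bivector -!/(coAdg _ _ _).
rewrite -(E (y^-1)%g lambda (coAdg theta (iota y) xi) (coAdg theta (iota y) eta)).
by rewrite iotaV !(coAdgM gG) mulgV !(coAdg1 gG).
Qed.

Lemma invariantM y z :
  invariant_under y -> invariant_under z -> invariant_under (y * z)%g.
Proof.
move=> Iy Iz lambda xi eta; rewrite (iota_morph H_sub).
rewrite -(coAdM gG); last by move=> X; exact: Ad_subalgebra.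
by rewrite -!(coAdgM gG) Iz Iy.
Qed.

Lemma invariantV y : invariant_under y -> invariant_under (y^-1)%g.
Proof.
move=> Iy lambda xi eta; rewrite -Iy.
rewrite (coAdM gG); last by move=> X; exact: Ad_subalgebra.
by rewrite !(coAdgM gG) iotaV mulVg (coAd1 gG) !(coAdg1 gG).
Qed.

Local Notation inf := (infinitesimal_variation br b r).

Lemma invariant_infinitesimal : (forall y, invariant_under y) ->
  forall X lambda xi eta, X \in h -> inf X lambda xi eta = 0.
Proof.
move=> I X lambda xi eta /subgroup_curve[z [sz z0 vX]].
have [_ <-] := is_derive_transport br_lie gG bh r_smooth lambda xi eta vX.
rewrite (_ : (fun s => _) = fun=> r lambda xi eta); first exact: derive_cst.
by apply/funext => s; exact: I.
Qed.

Hypothesis inf0 : forall X lambda xi eta, X \in h -> inf X lambda xi eta = 0.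

(** The derivative of the transport of r along y vanishes at every time t:
    y(t + s) = y(t) * z(s) where z starts at 1 with a velocity in h, so that it
    is an infinitesimal variation at the transported arguments. *)
Lemma invariant_curve (y : R -> H) : curve y -> y 0 = 1%g ->
  forall t, invariant_under (y t).
Proof.
move=> sy y0 t lambda xi eta.
pose Phi t := r (coAd theta (iota (y t)) lambda) (coAdg theta (iota (y t)) xi)
  (coAdg theta (iota (y t)) eta).
have -> : r lambda xi eta = Phi 0.
  by rewrite /Phi y0 iota1 (coAd1 gG) !(coAdg1 gG).
apply: (is_derive_0_is_cst (f := Phi)) => {}t.
pose z s := ((y t)^-1 * y (t + s))%g.
have sz : curve z.
  move=> s; apply: smooth_into_mul; first exact: smooth_into_cst.
  apply: (smooth_into_comp (g := fun s : R^o => t + s : R^o) (y := y)) => //.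
    exact: framed_real.
  by apply: smooth_at_add; [exact: smooth_at_cst|exact: smooth_at_id].
have z0 : z 0 = 1%g by rewrite /z addr0 mulVg.
have [X Xh vX] := subgroup_velocity sz z0.
have := is_derive_transport br_lie gG bh r_smooth (coAd theta (iota (y t)) lambda)
  (coAdg theta (iota (y t)) xi) (coAdg theta (iota (y t)) eta) vX.
rewrite inf0 // => D.
have E : (fun s => Phi (t + s)) = (fun s =>
  r (coAd theta ((iota \o z) s) (coAd theta (iota (y t)) lambda))
    (coAdg theta ((iota \o z) s) (coAdg theta (iota (y t)) xi))
    (coAdg theta ((iota \o z) s) (coAdg theta (iota (y t)) eta))).
  apply/funext => s; rewrite (coAdM gG); last by move=> Y; exact: Ad_subalgebra.
  by rewrite !(coAdgM gG) /= -(iota_morph H_sub) mulgA mulgV mul1g.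
by rewrite -E in D; exact: is_derive_translate.
Qed.

(** In a chart around 1, every point of a ball with center u0 lies on a curve
    t |-> u0 + sin t *: v which stays in the ball. *)
Lemma invariant_near : \forall x \near (1%g : H), invariant_under x.
Proof.
have [c Ac D1] := atlas_cover (1%g : H).
have [oD oR cK cc ic] := atlas_chart _ Ac.
pose u0 := cmap c 1%g.
have Ru0 : crange c u0 by exists 1%g.
have /nbhs_ballP[e /= e0 eR] : nbhs u0 (crange c) by exact: open_nbhs_nbhs.
have n1 : \forall x \near (1%g : H), cdom c x by exact: open_nbhs_nbhs.
have n2 : \forall x \near (1%g : H), ball u0 e (cmap c x).
  by apply: (cc _ D1); exact: nbhsx_ballx.
apply: filterS (filterI n1 n2) => x [Dx Bx].
pose v := cmap c x - u0.
pose k (t : R^o) := u0 + sin t *: v.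
have Rk t : crange c (k t).
  apply: eR; move: Bx; rewrite -!ball_normE /= => Bx.
  rewrite /k opprD addNKr normrN normrZ.
  apply: le_lt_trans Bx; rewrite distrC -/v ler_piMl //; exact: sin_max.
have sk (t : R^o) : smooth_at t k.
  apply: smooth_at_add; first exact: smooth_at_cst.
  apply/smooth_at_rV => i.
  have := smooth_at_mul (smooth_at_sin t) (smooth_at_cst t (v 0 i : R^o)).
  by congr smooth_at; apply/funext => s; rewrite [RHS]mxE.
have sy : curve (cinv c \o k).
  move=> t; apply: smooth_into_comp => //; first exact: framed_rV.
  exact: smooth_into_chart.
have y0 : (cinv c \o k) 0 = 1%g by rewrite /= /k sin0 scale0r addr0 cK.
have := invariant_curve sy y0 (pi / 2).
by rewrite /= /k sin_pihalf scale1r addrC subrK cK.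
Qed.

(** The set of the y that leave r invariant is a subgroup containing a
    neighborhood of 1, hence it is open and closed, and H is connected. *)
Lemma invariant_all y : invariant_under y.
Proof.
pose N := [set x | invariant_under x].
have trans (x : H) : \forall z \near x, invariant_under (x^-1 * z)%g.
  have c : {for x, continuous (fun z : H => (x^-1 * z)%g)}.
    have [ct _] := @mulg_smooth R m H.
    have c2 : {for x, continuous (fun z : H => (x^-1, z)%g)}.
      by apply: cvg_pair; [exact: cvg_cst|exact: cvg_id].
    exact: (continuous_comp c2 (ct _)).
  by apply: c; rewrite mulVg; exact: invariant_near.
have oN : open N.
  rewrite openE => x Nx; apply: filterS (trans x) => z Iz.
  by have := invariantM Nx Iz; rewrite mulgA mulgV mul1g.
have cN : closed N.
  rewrite -openC openE => x Nx; apply: filterS (trans x) => z Iz Nz.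
  apply: Nx; have := invariantM Nz (invariantV Iz).
  by rewrite invgM invgK mulgA mulgV mul1g.
have NT : N = setT.
  apply: (subgroup_connected H_sub).
  - exists 1%g => lambda xi eta; rewrite iota1 (coAd1 gG) !(coAdg1 gG) //.
  - by exists N => //; rewrite setTI.
  - by exists N => //; rewrite setTI.
by have : setT y by []; rewrite -NT.
Qed.

End Subgroup.


(** * Smooth functions on the product of the dual of h and G *)

Section DualPartialMul.
Context {R : realType} {g : vectType R} {h : {vspace g}} {l : nat}.
Context {b : l.-tuple g}.
Hypothesis bh : basis_of h b.
Local Notation hdual := (dual (subvs_of h)).

Lemma dual_cmap_shift lambda i (s : R) :
  cmap (dual_chart h b) (lambda + s *: dual_basis h b i) =
  cmap (dual_chart h b) lambda + s *: delta_mx 0 i.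
Proof.
rewrite -{1}(dual_cmapK bh lambda) -dual_cinv_shift.
exact: dual_cinvK.
Qed.

Lemma smooth_pairing X : smooth_fun [set dual_chart h b] (fun mu : hdual => pairing mu X).
Proof.
apply/(smooth_fun_dualP bh) => u.
have := smooth_at_sum (index_enum 'I_l) (P := predT) (fun i _ =>
  smooth_at_mul (iffLR (smooth_at_rV _ _) (smooth_at_id u) i)
    (smooth_at_cst u (pairing (h := h) (dual_basis h b i) X : R^o))).
congr smooth_at; apply/funext => v; rewrite /comp /pairing /= sum_lfunE.
by apply: eq_bigr => i _; rewrite scale_lfunE.
Qed.

Lemma dual_partial_pairing i X lambda : X \in h ->
  dual_partial b i (fun mu : hdual => pairing mu X) lambda = coord b i X.
Proof.
move=> Xh; rewrite /dual_partial (_ : (fun t => _) =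
    fun t : R => pairing lambda X + t * coord b i X).
  rewrite derive1E deriveD// derive_cst add0r deriveM// derive_cst derive_id.
  by rewrite scaler0 add0r /GRing.scale /= mulr1.
apply/funext => t; rewrite {1}/pairing add_lfunE scale_lfunE /dual_basis lfunE /=.
by rewrite vsprojK.
Qed.

End DualPartialMul.

Section FunctionsOnM.
Context {R : realType} {g : vectType R} {h : {vspace g}} {n : nat} {G : lieGroupType R n}.
Context {br : g -> g -> g} {theta : g -> (G -> R) -> R} {l : nat} {b : l.-tuple g}.
Hypothesis gG : is_lie_algebra_of br theta.
Hypothesis bh : basis_of h b.
Local Notation hdual := (dual (subvs_of h)).
Local Notation M := (hdual * G)%type.
Local Notation smoothG := (smooth_fun (@atlas R n G)).
Local Notation smoothM := (smooth_fun (@M_atlas R g h l b n G)).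
Local Notation smoothD := (smooth_fun [set dual_chart h b]).
Implicit Types (V : normedModType R) (f k : M -> R).

Lemma M_crange c : crange (prod_chart (dual_chart h b) c : chart M _) =
  setT `*` crange (c : chart G 'rV[R]_n).
Proof.
rewrite -(dual_crange bh).
apply/seteqP; split=> [_ [[s t] [/= Ds Dt] <-]|[u v] [[s Ds /= su] [t Dt /= tv]]].
  by split; [exists s|exists t].
by exists (s, t) => //=; rewrite su tv.
Qed.

Lemma M_open c : M_atlas b c -> open (crange (c : chart M ('rV[R]_l * 'rV[R]_n))).
Proof.
move=> [_ [d [-> Ad ->]]]; rewrite M_crange; apply: open_setX; first exact: openT.
exact: atlas_open.
Qed.

Lemma smooth_MP f : smoothM f <->
  forall c u w, atlas c -> crange c w ->
  smooth_at (u, w) (fun p => f (cinv (dual_chart h b) p.1, cinv c p.2) : R^o).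
Proof.
split=> [sf c u w Ac Rw|sf _ [_ [c [-> Ac ->]]]].
  have Mc : M_atlas b (prod_chart (dual_chart h b) c : chart M _).
    by exists (dual_chart h b), c.
  have /(smooth_onP _ (M_open Mc)) := sf _ Mc.
  by apply; rewrite M_crange.
apply/smooth_onP.
  rewrite M_crange; apply: open_setX; [exact: openT|exact: atlas_open].
by move=> [u w]; rewrite M_crange => -[_ Rw]; exact: sf.
Qed.

(** The test of smoothness on M by maps from a normed space.  The dual of h
    enters through its coordinates, as it carries no topology. *)
Lemma smooth_M_into V (x : V) (a : V -> hdual) (y : V -> G) f :
  smoothM f -> smooth_at x (cmap (dual_chart h b) \o a) -> smooth_into x y ->
  smooth_at x (fun v => f (a v, y v) : R^o).
Proof.
move=> /smooth_MP sf sa [cy sy]; have [c Ac Dc] := atlas_cover (y x).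
have [oD oR cK cc ic] := atlas_chart _ Ac.
have sc := smooth_at_pair sa (sy c Ac Dc).
have sF : smooth_at (cmap (dual_chart h b) (a x), cmap c (y x))
   (fun p => f (cinv (dual_chart h b) p.1, cinv c p.2) : R^o).
  by apply: sf => //; exists (y x).
have frE : framed ('rV[R]_l * 'rV[R]_n : normedModType R)%type.
  by apply: framed_pair; exact: framed_rV.
apply: smooth_at_eq (smooth_at_comp frE framed_real sc sF).
have nD : \forall v \near x, cdom c (y v) by apply: cy; exact: open_nbhs_nbhs.
apply: filterS nD => v Dv.
by rewrite -[LHS]/(f (cinv (dual_chart h b) (cmap (dual_chart h b) (a v)),
  cinv c (cmap c (y v)))) (dual_cmapK bh) cK.
Qed.

Lemma smooth_slice_G f lambda : smoothM f -> smoothG (fun y => f (lambda, y)).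
Proof.
move=> sf; apply/smooth_funP => c u Ac Ru.
apply: (smooth_M_into (a := fun=> lambda) (y := cinv c)) => //.
  exact: smooth_at_cst.
exact: smooth_into_chart.
Qed.

Lemma smooth_slice_translate f lambda x :
  smoothM f -> smoothG (fun y => f (lambda, (x * y)%g)).
Proof. by move=> /(smooth_slice_G lambda); exact: smooth_fun_ltranslate. Qed.

Lemma smooth_slice_dual f x : smoothM f -> smoothD (fun mu => f (mu, x)).
Proof.
move=> sf; apply/(smooth_fun_dualP bh) => u.
apply: (smooth_M_into (a := cinv (dual_chart h b)) (y := fun=> x)) => //.
  by apply: smooth_at_eq (smooth_at_id u); near=> v; rewrite /comp (dual_cinvK bh).
exact: smooth_into_cst.
Unshelve. all: by end_near. Qed.

Lemma smooth_M_fst (F : hdual -> R) : smoothD F -> smoothM (fun p => F p.1).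
Proof.
move=> /(smooth_fun_dualP bh) sF; apply/smooth_MP => c u w Ac Rw.
apply: (smooth_at_comp (g := fst) (f := F \o cinv (dual_chart h b) : _ -> R^o)) => //.
- exact: framed_rV.
- exact: framed_real.
- exact: smooth_at_fst.
Qed.

Lemma smooth_M_snd (F : G -> R) : smoothG F -> smoothM (fun p => F p.2).
Proof.
move=> /smooth_funP sF; apply/smooth_MP => c u w Ac Rw.
apply: (smooth_at_comp (g := snd) (f := F \o cinv c : _ -> R^o)).
- exact: framed_rV.
- exact: framed_real.
- exact: smooth_at_snd.
- exact: sF.
Qed.

Lemma smooth_arrow X f : smoothM f -> smoothM (arrow theta X f).
Proof.
move=> sf; apply/smooth_MP => c u w Ac Rw.
have frM : framed ('rV[R]_l * 'rV[R]_n : normedModType R)%type.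
  by apply: framed_pair; exact: framed_rV.
apply: (smooth_theta gG (F := fun p z => f (cinv (dual_chart h b) p.1, (cinv c p.2 * z)%g)))
  => [//|z sz|p].
  apply: (smooth_M_into (a := fun p : ('rV[R]_l * 'rV[R]_n) * R^o => cinv (dual_chart h b) p.1.1)
    (y := fun p : ('rV[R]_l * 'rV[R]_n) * R^o => (cinv c p.1.2 * z p.2)%g)) => //.
    apply: (@smooth_at_eq _ _ _ _ (fun p => p.1.1)).
      by near=> p; rewrite /comp (dual_cinvK bh).
    apply: (smooth_at_comp (g := fst) (f := fst)) => //; first exact: framed_rV.
      exact: smooth_at_fst.
    exact: smooth_at_fst.
  apply: smooth_into_mul.
    have s2 : smooth_at ((u, w), 0 : R^o)
        (fun p : ('rV[R]_l * 'rV[R]_n) * R^o => p.1.2).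
      apply: (smooth_at_comp (g := fst) (f := snd)) => //; first exact: framed_rV.
        exact: smooth_at_fst.
      exact: smooth_at_snd.
    apply: (smooth_into_comp (framed_rV _) s2).
    exact: smooth_into_chart.
  by apply: (smooth_into_comp (g := snd)); [exact: framed_real|exact: smooth_at_snd|].
exact: smooth_slice_translate.
Unshelve. all: by end_near. Qed.

Lemma smooth_d_dlambda i f : smoothM f -> smoothM (d_dlambda b i f).
Proof.
move=> sf; apply/smooth_MP => c u w Ac Rw.
pose F (p : 'rV[R]_l * 'rV[R]_n) : R^o := f (cinv (dual_chart h b) p.1, cinv c p.2).
have sF : smooth_at (u, w) F by move/smooth_MP: sf; apply.
have := smooth_at_derive (delta_mx 0 i, 0) sF; congr smooth_at; apply/funext => -[u' w'].
rewrite -derive1_line /d_dlambda /dual_partial; congr (derive1 _ 0); apply/funext => t.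
by rewrite /F -[LHS]/(f (cinv (dual_chart h b) (u' + t *: delta_mx 0 i), cinv c (w' + t *: 0)))
  dual_cinv_shift scaler0 addr0.
Qed.

Lemma arrow_linear a X Y f p : smoothM f ->
  arrow theta (a *: X + Y) f p = a * arrow theta X f p + arrow theta Y f p.
Proof.
move=> sf; apply: (theta_linear gG).
exact: smooth_slice_translate.
Qed.

Lemma arrow_bracket X Y f p : smoothM f ->
  arrow theta (br X Y) f p =
  arrow theta X (arrow theta Y f) p - arrow theta Y (arrow theta X f) p.
Proof.
move=> sf; rewrite /arrow {1}/left_field (theta_bracket gG); last first.
  exact: smooth_slice_translate.
rewrite /left_field; congr (theta _ _ - theta _ _); apply/funext => y;
  by congr (theta _); apply/funext => z; rewrite mulgA.
Qed.

(** The two derivatives are the partial derivatives at 0 of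
    f (lambda + s *: e_i, x * z(t)), for e_i dual to the basis and z a curve
    with velocity X. *)
Lemma arrow_d_dlambda X i f p : smoothM f ->
  arrow theta X (d_dlambda b i f) p = d_dlambda b i (arrow theta X f) p.
Proof.
case: p => lambda x sf; have [z [sz z0 Xz]] := exists_curve gG X.
rewrite /arrow /left_field /= Xz; last first.
  exact/smooth_slice_translate/smooth_d_dlambda.
pose k (p : R^o * R^o) : R^o := f (lambda + p.1 *: dual_basis h b i, (x * z p.2)%g).
have sk : smooth_at (0, 0) k.
  apply: (smooth_M_into (a := fun p : R^o * R^o => lambda + p.1 *: dual_basis h b i)
     (y := fun p : R^o * R^o => (x * z p.2)%g)) => //.
    apply: (@smooth_at_eq _ _ _ _ (fun p : R^o * R^o =>
        cmap (dual_chart h b) lambda + p.1 *: delta_mx 0 i)).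
      by near=> p; rewrite /comp (dual_cmap_shift bh).
    apply: smooth_at_add; first exact: smooth_at_cst.
    apply/smooth_at_rV => j.
    apply: (@smooth_at_eq _ _ _ _ (fun p : R^o * R^o => p.1 * delta_mx 0 i 0 j : R^o)).
      by near=> p; rewrite [RHS]mxE.
    by apply: smooth_at_mul; [exact: smooth_at_fst|exact: smooth_at_cst].
  apply: smooth_into_mul; first exact: smooth_into_cst.
  by apply: (smooth_into_comp (g := snd)); [exact: framed_real|exact: smooth_at_snd|].
transitivity (derive1 (fun t : R => derive1 (fun s : R => k (s, t) : R) 0) 0) => //.
rewrite -(derive1_comm sk) /d_dlambda /dual_partial; congr (derive1 _ 0).
apply/funext => s; rewrite /arrow /left_field Xz //.
exact: smooth_slice_translate.
Unshelve. all: by end_near. Qed.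

Lemma d_dlambda_comm i j f p : smoothM f ->
  d_dlambda b i (d_dlambda b j f) p = d_dlambda b j (d_dlambda b i f) p.
Proof.
case: p => lambda x sf.
pose k (p : R^o * R^o) : R^o :=
  f (lambda + p.1 *: dual_basis h b i + p.2 *: dual_basis h b j, x).
have sk : smooth_at (0, 0) k.
  apply: (smooth_M_into (a := fun p : R^o * R^o =>
      lambda + p.1 *: dual_basis h b i + p.2 *: dual_basis h b j) (y := fun=> x)) => //.
    apply: (@smooth_at_eq _ _ _ _ (fun p : R^o * R^o =>
        cmap (dual_chart h b) lambda + p.1 *: delta_mx 0 i + p.2 *: delta_mx 0 j)).
      by near=> p; rewrite /comp !(dual_cmap_shift bh).
    apply: smooth_at_add; last first.
      apply/smooth_at_rV => q.
      apply: (@smooth_at_eq _ _ _ _ (fun p : R^o * R^o => p.2 * delta_mx 0 j 0 q : R^o)).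
        by near=> p; rewrite [RHS]mxE.
      by apply: smooth_at_mul; [exact: smooth_at_snd|exact: smooth_at_cst].
    apply: smooth_at_add; first exact: smooth_at_cst.
    apply/smooth_at_rV => q.
    apply: (@smooth_at_eq _ _ _ _ (fun p : R^o * R^o => p.1 * delta_mx 0 i 0 q : R^o)).
      by near=> p; rewrite [RHS]mxE.
    by apply: smooth_at_mul; [exact: smooth_at_fst|exact: smooth_at_cst].
  exact: smooth_into_cst.
rewrite -[LHS]/(derive1 (fun s : R => derive1 (fun t : R => k (s, t) : R) 0) 0).
rewrite (derive1_comm sk) /d_dlambda /dual_partial; congr (derive1 _ 0); apply/funext => t.
by congr (derive1 _ 0); apply/funext => s; rewrite /k /= addrAC.
Unshelve. all: by end_near. Qed.

Lemma arrow_fun_linear X a f k p : smoothM f -> smoothM k ->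
  arrow theta X (fun q => a * f q + k q) p = a * arrow theta X f p + arrow theta X k p.
Proof.
move=> sf sk; rewrite /arrow /left_field (theta_linear_fun gG) //;
  exact: smooth_slice_translate.
Qed.

Lemma arrow_leibniz X f k p : smoothM f -> smoothM k ->
  arrow theta X (fun q => f q * k q) p = f p * arrow theta X k p + arrow theta X f p * k p.
Proof.
case: p => lambda x sf sk; rewrite /arrow /left_field (theta_leibniz gG) /= ?mulg1 //;
  exact: smooth_slice_translate.
Qed.

Lemma d_dlambda_linear i a f k p : smoothM f -> smoothM k ->
  d_dlambda b i (fun q => a * f q + k q) p = a * d_dlambda b i f p + d_dlambda b i k p.
Proof.
by move=> sf sk; apply: (dual_partial_linear bh); exact: smooth_slice_dual.
Qed.

Lemma d_dlambda_leibniz i f k p : smoothM f -> smoothM k ->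
  d_dlambda b i (fun q => f q * k q) p = f p * d_dlambda b i k p + d_dlambda b i f p * k p.
Proof.
move=> sf sk; case: p => lambda x; rewrite /d_dlambda (dual_partial_mul bh) //;
  exact: smooth_slice_dual.
Qed.

Lemma arrow_fst X (F : hdual -> R) p : arrow theta X (fun q : M => F q.1) p = 0.
Proof.
rewrite /arrow /left_field /=; have [z [_ _ ->]] := exists_curve gG X.
  exact: derive1_cst.
exact: smooth_fun_cst.
Qed.

Lemma d_dlambda_snd i (F : G -> R) p : d_dlambda b i (fun q : M => F q.2) p = 0.
Proof. by rewrite /d_dlambda /dual_partial /=; exact: derive1_cst. Qed.

(** The function is the sum of a linear function of lambda and of the left
    translate to p.2 of a function on G provided by [cotangent_onto]. *)
Lemma covector_onto p X (xi : dual g) : X \in h ->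
  exists f, [/\ smoothM f, dual_gradient b f p = X &
    forall Y, arrow theta Y f p = xi Y].
Proof.
move=> Xh; have [F sF FE] := cotangent_onto gG xi.
pose f1 (q : M) := pairing q.1 X; pose f2 (q : M) := F (p.2^-1 * q.2)%g.
have s1 : smoothM f1 := smooth_M_fst (smooth_pairing bh X).
have s2 : smoothM f2 := smooth_M_snd (smooth_fun_ltranslate (p.2^-1)%g sF).
have d1 i : d_dlambda b i f1 p = coord b i X by exact: dual_partial_pairing.
have d2 i : d_dlambda b i f2 p = 0.
  exact: (d_dlambda_snd _ (fun y => F (p.2^-1 * y)%g)).
have d3 Y : arrow theta Y f1 p = 0 by exact: (arrow_fst Y (fun mu => pairing mu X)).
exists (fun q => 1 * f1 q + f2 q); split.
- exact: (smooth_fun_linear M_open).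
- rewrite /dual_gradient [RHS](coord_basis bh Xh); apply: eq_bigr => i _.
  by rewrite d_dlambda_linear // d2 addr0 mul1r d1 (tnth_nth 0).
- move=> Y; rewrite arrow_fun_linear // d3 mulr0 add0r -FE.
  rewrite /arrow /left_field /f2; congr (theta Y); apply/funext => y /=.
  by rewrite mulgA mulVg mul1g.
Qed.

End FunctionsOnM.


(** * The Jacobiator in a frame, and the Schouten bracket *)

Section FrameJacobi.
Context {R : comNzRingType} {T : Type} {I : finType}.
Context (S : (T -> R) -> Prop) (E : I -> (T -> R) -> T -> R) (Pi : I -> I -> T -> R).
Hypothesis S_cst : forall a, S (fun=> a).
Hypothesis S_add : forall f k, S f -> S k -> S (fun p => f p + k p).
Hypothesis S_mul : forall f k, S f -> S k -> S (fun p => f p * k p).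
Hypothesis S_Pi : forall A B, S (Pi A B).
Hypothesis S_E : forall A f, S f -> S (E A f).
Hypothesis E_linear : forall A a f k p, S f -> S k ->
  E A (fun q => a * f q + k q) p = a * E A f p + E A k p.
Hypothesis E_leibniz : forall A f k p, S f -> S k ->
  E A (fun q => f q * k q) p = f p * E A k p + E A f p * k p.
Hypothesis Pi_skew : forall A B p, Pi B A p = - Pi A B p.
Implicit Types (f k q : T -> R).

Definition frame_bivector f k p := \sum_A \sum_B Pi A B p * E A f p * E B k p.

(** The components in the frame of the Hamiltonian vector field of f. *)
Definition hamiltonian f B p := \sum_A Pi A B p * E A f p.

Let S_sum J (s : seq J) (F : J -> T -> R) :
  (forall j, S (F j)) -> S (fun p => \sum_(j <- s) F j p).
Proof.
move=> SF; elim: s => [|j s IH].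
  by under eq_fun do rewrite big_nil; exact: S_cst.
by under eq_fun do rewrite big_cons; exact: S_add.
Qed.

Let E_sum A J (s : seq J) (F : J -> T -> R) p :
  (forall j, S (F j)) ->
  E A (fun p => \sum_(j <- s) F j p) p = \sum_(j <- s) E A (F j) p.
Proof.
move=> SF; elim: s => [|j s IH].
  rewrite big_nil; under [X in E A X]eq_fun do rewrite big_nil.
  have := @E_linear A (-1) (fun=> 0) (fun=> 0) p (S_cst 0) (S_cst 0).
  by rewrite mulr0 addr0 mulN1r addNr.
rewrite big_cons -IH.
have := @E_linear A 1 (F j) (fun p => \sum_(j <- s) F j p) p (SF j) (S_sum _ SF).
rewrite mul1r => <-; congr (E A _ p); apply/funext => x.
by rewrite big_cons mul1r.
Qed.

Lemma frame_bivector_smooth f k : S f -> S k -> S (frame_bivector f k).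
Proof.
move=> Sf Sk; apply: S_sum => A; apply: S_sum => B.
by apply: S_mul; [apply: S_mul => //|]; exact: S_E.
Qed.

Lemma frame_bivector_skew f k p : frame_bivector f k p = - frame_bivector k f p.
Proof.
rewrite /frame_bivector exchange_big -sumrN; apply: eq_bigr => A _.
by rewrite -sumrN; apply: eq_bigr => B _; rewrite Pi_skew; ring.
Qed.

Lemma frame_bivector_linear a f f' k p : S f -> S f' -> S k ->
  frame_bivector (fun x => a * f x + f' x) k p =
  a * frame_bivector f k p + frame_bivector f' k p.
Proof.
move=> Sf Sf' Sk; rewrite /frame_bivector mulr_sumr -big_split; apply: eq_bigr => A _ /=.
by rewrite mulr_sumr -big_split; apply: eq_bigr => B _ /=; rewrite E_linear //; ring.
Qed.

Lemma frame_bivector_leibniz f f' k p : S f -> S f' -> S k ->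
  frame_bivector (fun x => f x * f' x) k p =
  f p * frame_bivector f' k p + frame_bivector f k p * f' p.
Proof.
move=> Sf Sf' Sk; rewrite /frame_bivector mulr_sumr mulr_suml -big_split.
apply: eq_bigr => A _ /=; rewrite mulr_sumr mulr_suml -big_split.
by apply: eq_bigr => B _ /=; rewrite E_leibniz //; ring.
Qed.

Lemma frame_bivectorE f k p :
  frame_bivector f k p = \sum_B hamiltonian f B p * E B k p.
Proof.
rewrite /frame_bivector exchange_big; apply: eq_bigr => B _.
by rewrite /hamiltonian mulr_suml.
Qed.

Lemma hamiltonianN k A p : \sum_B Pi A B p * E B k p = - hamiltonian k A p.
Proof.
by rewrite /hamiltonian -sumrN; apply: eq_bigr => B _; rewrite Pi_skew; ring.
Qed.

(** The coefficients of the bivector, differentiated along the Hamiltonian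
    field of f and contracted with the differentials of k and q. *)
Definition tensor_variation f k q p :=
  \sum_A \sum_B (\sum_C hamiltonian f C p * E C (Pi A B) p) * E A k p * E B q p.

(** The second derivative of k along the Hamiltonian fields of f and q, whose
    coefficients are not differentiated. *)
Definition hamiltonian_hessian k f q p :=
  \sum_A \sum_B hamiltonian f A p * hamiltonian q B p * E A (E B k) p.

(** The commutator of the Hamiltonian fields of q and f with coefficients frozen
    at p, applied to k. *)
Definition frame_curvature k q f p :=
  \sum_A \sum_B hamiltonian q A p * hamiltonian f B p *
    (E A (E B k) p - E B (E A k) p).

Lemma hessian_skew k q f p :
  hamiltonian_hessian k q f p - hamiltonian_hessian k f q p = frame_curvature k q f p.
Proof.
rewrite /hamiltonian_hessian [X in _ - X]exchange_big -sumrB; apply: eq_bigr => A _.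
by rewrite -sumrB; apply: eq_bigr => B _; ring.
Qed.

Lemma frame_bivector_iter f k q p : S f -> S k -> S q ->
  frame_bivector f (frame_bivector k q) p =
  tensor_variation f k q p - hamiltonian_hessian k f q p + hamiltonian_hessian q f k p.
Proof.
move=> Sf Sk Sq; rewrite frame_bivectorE.
have EP C : E C (frame_bivector k q) p = \sum_A \sum_B
    (E C (Pi A B) p * E A k p * E B q p + Pi A B p * E C (E A k) p * E B q p +
     Pi A B p * E A k p * E C (E B q) p).
  have SAB A B : S (fun x => Pi A B x * E A k x * E B q x).
    by apply: S_mul; [apply: S_mul => //|]; exact: S_E.
  rewrite /frame_bivector E_sum => [|A]; last exact: S_sum.
  apply: eq_bigr => A _; rewrite E_sum //; apply: eq_bigr => B _.
  rewrite E_leibniz; [|by apply: S_mul => //; exact: S_E|exact: S_E].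
  by rewrite E_leibniz //; [ring|exact: S_E].
under eq_bigr do rewrite EP.
have -> : \sum_C hamiltonian f C p * (\sum_A \sum_B
    (E C (Pi A B) p * E A k p * E B q p + Pi A B p * E C (E A k) p * E B q p +
     Pi A B p * E A k p * E C (E B q) p)) =
  tensor_variation f k q p +
  \sum_C \sum_A hamiltonian f C p * E C (E A k) p * (\sum_B Pi A B p * E B q p) +
  \sum_C \sum_B hamiltonian f C p * E C (E B q) p * (\sum_A Pi A B p * E A k p).
  have -> : tensor_variation f k q p = \sum_C \sum_A \sum_B
      hamiltonian f C p * E C (Pi A B) p * E A k p * E B q p.
    rewrite /tensor_variation [RHS]exchange_big; apply: eq_bigr => A _.
    rewrite [RHS]exchange_big; apply: eq_bigr => B _.
    by rewrite !mulr_suml.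
  have -> : \sum_C \sum_B hamiltonian f C p * E C (E B q) p *
      (\sum_A Pi A B p * E A k p) =
    \sum_C \sum_A \sum_B hamiltonian f C p * E C (E B q) p * (Pi A B p * E A k p).
    apply: eq_bigr => C _; rewrite [RHS]exchange_big; apply: eq_bigr => B _.
    by rewrite mulr_sumr.
  rewrite -!big_split; apply: eq_bigr => C _ /=.
  rewrite mulr_sumr -!big_split; apply: eq_bigr => A _ /=.
  rewrite !mulr_sumr -!big_split; apply: eq_bigr => B _ /=.
  by ring.
congr (_ + _ + _).
  rewrite -sumrN; apply: eq_bigr => C _; rewrite -sumrN; apply: eq_bigr => A _.
  by rewrite hamiltonianN; ring.
apply: eq_bigr => C _; apply: eq_bigr => B _.
by rewrite -/(hamiltonian k B p); ring.
Qed.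

(** Each function has its second derivatives in two of the three terms, with
    opposite signs and the two frame fields exchanged: what remains of them are
    the commutators of the frame. *)
Lemma frame_jacobiator f k q p : S f -> S k -> S q ->
  frame_bivector f (frame_bivector k q) p + frame_bivector k (frame_bivector q f) p +
  frame_bivector q (frame_bivector f k) p =
  (tensor_variation f k q p + frame_curvature k q f p) +
  (tensor_variation k q f p + frame_curvature q f k p) +
  (tensor_variation q f k p + frame_curvature f k q p).
Proof.
by move=> Sf Sk Sq; rewrite !frame_bivector_iter // -!hessian_skew; ring.
Qed.

End FrameJacobi.

Section Sharp.
Context {R : realType} {g : vectType R} {br : g -> g -> g}.
Hypothesis br_lie : lie_bracket br.
Implicit Types (w : bivector g) (xi eta zeta : dual g).

(** The vector obtained by contracting w with xi; see [sharpE]. *)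
Definition sharp w xi : g := \sum_a w xi (gcoord a) *: tnth gbasis a.

Lemma brC x y : br x y = - br y x.
Proof.
have D u v z : br (u + v) z = br u z + br v z.
  by have := br_linearl br_lie 1 u v z; rewrite !scale1r.
have D' u v z : br z (u + v) = br z u + br z v.
  by have := br_linearr br_lie 1 u v z; rewrite !scale1r.
apply/eqP; rewrite -addr_eq0; have := brxx br_lie (x + y).
by rewrite D !D' !(brxx br_lie) add0r addr0 => ->.
Qed.

Lemma bivector_skew w xi eta : w xi eta = - w eta xi.
Proof.
have D u v z : w (u + v) z = w u z + w v z.
  by have := bivector_linearl w 1 u v z; rewrite scale1r mul1r.
have D' u v z : w z (u + v) = w z u + w z v.
  by have := bivector_linearr w 1 u v z; rewrite scale1r mul1r.
apply/eqP; rewrite -addr_eq0; have := bivector_alt w (xi + eta).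
by rewrite D !D' !bivector_alt add0r addr0 => ->.
Qed.

Lemma sharpE w xi eta : eta (sharp w xi) = w xi eta.
Proof.
have R0 (k : dual g) : w k 0 = 0.
  have := bivector_linearr w (-1) 0 0 k.
  by rewrite scaler0 addr0 mulN1r addNr.
rewrite /sharp linear_sum /= [in RHS](covector_expand eta).
under eq_bigr do rewrite linearZ /=.
elim/big_rec2: _ => [|i y1 y2 _ ->]; first by rewrite R0.
by rewrite bivector_linearr; congr (_ + _); exact: mulrC.
Qed.

Lemma sharp_expand w xi :
  sharp w xi = - \sum_i \sum_j (w (gcoord i) (gcoord j) * xi (tnth gbasis j)) *: tnth gbasis i.
Proof.
rewrite -sumrN; apply: eq_bigr => i _; rewrite -scaler_suml -scaleNr; congr (_ *: _).
rewrite bivector_skew; congr (- _).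
have -> : w (gcoord i) xi = xi (sharp w (gcoord i)) by rewrite sharpE.
rewrite /sharp linear_sum /=; apply: eq_bigr => j _; rewrite linearZ //.
Qed.

(** By the skew-symmetry of w, the four terms of [schouten_decomposable]
    contribute equally, and contracting w with a covector gives [sharp]. *)
Lemma schouten_sharp w xi eta zeta :
  schouten br w w xi eta zeta = 2 *
   (xi (br (sharp w eta) (sharp w zeta)) + eta (br (sharp w zeta) (sharp w xi)) +
    zeta (br (sharp w xi) (sharp w eta))).
Proof.
pose W i j := w (gcoord i) (gcoord j).
have Wskew i j : W i j = - W j i by exact: bivector_skew.
pose e (j : 'I_(\dim (fullv : {vspace g}))) : g := tnth gbasis j.
pose S4 (F : _ -> _ -> _ -> _ -> R) := \sum_i \sum_j \sum_k \sum_l W i j * W k l * F i j k l.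
have S4_kl F : S4 (fun i j k l => F i j l k) = - S4 F.
  rewrite /S4 -sumrN; apply: eq_bigr => i _; rewrite -sumrN; apply: eq_bigr => j _.
  rewrite exchange_big -sumrN; apply: eq_bigr => k _; rewrite -sumrN; apply: eq_bigr => q _.
  by rewrite (Wskew q k); ring.
have S4_ij F : S4 (fun i j k l => F j i k l) = - S4 F.
  rewrite /S4 exchange_big -sumrN; apply: eq_bigr => i _; rewrite -sumrN; apply: eq_bigr => j _.
  rewrite -sumrN; apply: eq_bigr => k _; rewrite -sumrN; apply: eq_bigr => q _.
  by rewrite (Wskew j i); ring.
pose Q (a c d : dual g) := S4 (fun i j k l => a (br (e i) (e k)) * c (e j) * d (e l)).
have QE a c d : Q a c d = a (br (sharp w c) (sharp w d)).
  have brl (v : dual g) y : linear (fun x => v (br x y) : R^o).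
    by move=> s x x'; rewrite (br_linearl br_lie) linearP.
  have brr (v : dual g) y : linear (fun x => v (br y x) : R^o).
    by move=> s x x'; rewrite (br_linearr br_lie) linearP.
  have sumE (v : dual g) (phi : g -> R^o) : linear phi ->
      phi (sharp w v) = - \sum_i \sum_j W i j * v (e j) * phi (e i).
    move=> lin; pose fM := GRing.isLinear.Build _ _ _ _ _ lin.
    pose fL : {linear g -> R^o} := HB.pack phi fM.
    rewrite sharp_expand -[phi]/(fL : g -> R^o) linearN linear_sum; congr (- _).
    apply: eq_bigr => i _; rewrite linear_sum; apply: eq_bigr => j _.
    by rewrite linearZ.
  rewrite (sumE _ _ (brl a (sharp w d))) /Q /S4 -sumrN; apply: eq_bigr => i _.
  rewrite -sumrN; apply: eq_bigr => j _.
  rewrite (sumE _ _ (brr a (e i))) mulrN opprK mulr_sumr; apply: eq_bigr => k _.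
  by rewrite mulr_sumr; apply: eq_bigr => q _; ring.
have Qskew a c d : Q a c d = - Q a d c.
  by rewrite !QE brC linearN.
pose W3 i j k l := wedge3 (br (e i) (e k)) (e j) (e l) xi eta zeta.
have -> : schouten br w w xi eta zeta = 4^-1 * S4 (fun i j k l =>
    W3 i j k l - W3 i j l k - W3 j i k l + W3 j i l k) by [].
have -> : S4 (fun i j k l => W3 i j k l - W3 i j l k - W3 j i k l + W3 j i l k) =
    4 * S4 W3.
  have e1 := S4_kl W3; have e2 := S4_ij W3.
  have e3 := S4_kl (fun i j k l => W3 j i k l).
  transitivity (S4 W3 - S4 (fun i j k l => W3 i j l k) - S4 (fun i j k l => W3 j i k l)
      + S4 (fun i j k l => W3 j i l k)).
    rewrite /S4 -!sumrB -big_split; apply: eq_bigr => i _ /=.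
    rewrite -!sumrB -big_split; apply: eq_bigr => j _ /=.
    rewrite -!sumrB -big_split; apply: eq_bigr => k _ /=.
    rewrite -!sumrB -big_split; apply: eq_bigr => q _ /=.
    by rewrite mulrDr !mulrBr.
  by rewrite e3 e2 e1; ring.
have -> : S4 W3 = 2 * (Q xi eta zeta + Q eta zeta xi + Q zeta xi eta).
  have -> : S4 W3 = Q xi eta zeta - Q xi zeta eta - (Q eta xi zeta - Q eta zeta xi)
     + (Q zeta xi eta - Q zeta eta xi).
    rewrite /Q /S4 -!sumrB -big_split; apply: eq_bigr => i _ /=.
    rewrite -!sumrB -big_split; apply: eq_bigr => j _ /=.
    rewrite -!sumrB -big_split; apply: eq_bigr => k _ /=.
    rewrite -!sumrB -big_split; apply: eq_bigr => q _ /=.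
    by rewrite /W3 /wedge3 /wedge12 /wedge2; ring.
  by rewrite (Qskew xi zeta) (Qskew eta xi) (Qskew zeta eta); ring.
by rewrite !QE; field.
Qed.

End Sharp.


(** * The frame of the d/dlambda^i and of the left-invariant fields *)

Section LinearSums.
Context {R : realType} {g : vectType R}.

Definition linear_form (phi : g -> R) :=
  forall (a : R) x y, phi (a *: x + y) = a * phi x + phi y.

Lemma linear_form_sum (phi : g -> R) J (s : seq J) (a : J -> R) (x : J -> g) :
  linear_form phi ->
  phi (\sum_(j <- s) a j *: x j) = \sum_(j <- s) a j * phi (x j).
Proof.
move=> lin; have phi0 : phi 0 = 0.
  by have := lin (-1) 0 0; rewrite scaler0 addr0 mulN1r addNr.
by elim/big_rec2: _ => [//|j u v _ <-]; rewrite lin.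
Qed.

Lemma linear_form_dual (xi : dual g) : linear_form xi.
Proof. by move=> a x y; rewrite linearP. Qed.

Lemma linear_form_br (br : g -> g -> g) (phi : g -> R) : lie_bracket br ->
  linear_form phi ->
  (forall y, linear_form (fun x => phi (br x y))) *
  (forall y, linear_form (fun x => phi (br y x))).
Proof.
move=> br_lie lin; split=> y a u v /=.
  by rewrite (br_linearl br_lie) lin.
by rewrite (br_linearr br_lie) lin.
Qed.

Lemma linear_form_br_sum (br : g -> g -> g) (phi : g -> R) J J' (s : seq J) (s' : seq J')
    (a : J -> R) (x : J -> g) (c : J' -> R) (y : J' -> g) : lie_bracket br ->
  linear_form phi ->
  phi (br (\sum_(i <- s) a i *: x i) (\sum_(j <- s') c j *: y j)) =
  \sum_(i <- s) \sum_(j <- s') a i * c j * phi (br (x i) (y j)).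
Proof.
move=> br_lie lin; have [l1 l2] := linear_form_br br_lie lin.
rewrite (linear_form_sum _ _ _ (l1 _)); apply: eq_bigr => i _.
rewrite (linear_form_sum _ _ _ (l2 _)) mulr_sumr; apply: eq_bigr => j _.
by rewrite mulrA.
Qed.

End LinearSums.

Section Jacobiator.
Context {R : realType} {g : vectType R} {h : {vspace g}} {n : nat} {G : lieGroupType R n}.
Context (br : g -> g -> g) (theta : g -> (G -> R) -> R) {l : nat} (b : l.-tuple g).
Hypothesis br_lie : lie_bracket br.
Hypothesis h_sub : lie_subalgebra br h.
Hypothesis gG : is_lie_algebra_of br theta.
Hypothesis bh : basis_of h b.
Local Notation hdual := (dual (subvs_of h)).
Local Notation M := (hdual * G)%type.
Local Notation smoothM := (smooth_fun (@M_atlas R g h l b n G)).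
Local Notation smoothD := (smooth_fun [set dual_chart h b]).
Context (r : hdual -> bivector g).
Hypothesis r_smooth : smooth_bivector_valued b r.
Implicit Types (f k q : M -> R) (p : M) (lambda : hdual).
Local Notation d := (\dim (fullv : {vspace g})).
Local Notation I := ('I_l + 'I_d)%type.

Definition frame (A : I) (f : M -> R) (p : M) : R :=
  match A with
  | inl i => d_dlambda b i f p
  | inr a => arrow theta (tnth gbasis a) f p
  end.

Definition bivector_coef (A B : I) (lambda : hdual) : R :=
  match A, B with
  | inl i, inl j => pairing lambda (br (tnth b i) (tnth b j))
  | inl i, inr a => gcoord a (tnth b i)
  | inr a, inl i => - gcoord a (tnth b i)
  | inr a, inr c => r lambda (gcoord a) (gcoord c)
  end.

Local Notation Pi := (fun (A B : I) (p : M) => bivector_coef A B p.1).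
Local Notation ham := (hamiltonian frame Pi).

Definition left_differential f p : dual g := linfun (fun X => arrow theta X f p : R^o).

Lemma left_differentialE f p X : smoothM f ->
  left_differential f p X = arrow theta X f p.
Proof.
by move=> sf; apply: linfun_linear => a Y Z; rewrite (arrow_linear gG bh).
Qed.

Lemma dual_gradient_mem f p : dual_gradient b f p \in h.
Proof.
by rewrite memv_suml // => i _; rewrite memvZ // (mem_basis_tuple bh).
Qed.

Lemma bivector_coef_smooth A B : smoothD (bivector_coef A B).
Proof.
case: A B => [i|a] [j|c] /=.
- exact: (smooth_pairing bh).
- exact: smooth_fun_cst.
- exact: smooth_fun_cst.
- exact: r_smooth.
Qed.

Lemma bivector_coef_skew A B lambda : bivector_coef B A lambda = - bivector_coef A B lambda.
Proof.
case: A B => [i|a] [j|c] /=.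
- rewrite (brC br_lie) /pairing !linearN //.
- by [].
- by rewrite opprK.
- exact: bivector_skew.
Qed.

Lemma frame_smooth A f : smoothM f -> smoothM (frame A f).
Proof.
by case: A => [i|a] sf; [exact: (smooth_d_dlambda bh)|exact: (smooth_arrow gG bh)].
Qed.

Lemma frame_linear A a f k p : smoothM f -> smoothM k ->
  frame A (fun x => a * f x + k x) p = a * frame A f p + frame A k p.
Proof.
case: A => [i|c] sf sk; first exact: (d_dlambda_linear bh).
exact: (arrow_fun_linear gG bh).
Qed.

Lemma frame_leibniz A f k p : smoothM f -> smoothM k ->
  frame A (fun x => f x * k x) p = f p * frame A k p + frame A f p * k p.
Proof.
case: A => [i|c] sf sk; first exact: (d_dlambda_leibniz bh).
exact: (arrow_leibniz gG bh).
Qed.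

Lemma r_bivector_frame f k p : smoothM f -> smoothM k ->
  r_bivector_field b br theta r f k p = frame_bivector frame Pi f k p.
Proof.
move=> sf sk.
have arrow_expand (X : g) (u : M -> R) : smoothM u ->
    arrow theta X u p = \sum_a gcoord a X * arrow theta (tnth gbasis a) u p.
  move=> su; rewrite {1}(gbasis_sum X).
  apply: (@linear_form_sum _ _ (fun X => arrow theta X u p)) => a x y.
  exact: (arrow_linear gG bh).
have T1 : lie_poisson b br f k p = \sum_i \sum_j
    bivector_coef (inl i) (inl j) p.1 * frame (inl i) f p * frame (inl j) k p.
  rewrite /lie_poisson /dual_gradient.
  rewrite (linear_form_br_sum _ _ _ _ _ _ br_lie (fun a x y => pairing_linear p.1 a x y)).
  by apply: eq_bigr => i _; apply: eq_bigr => j _ /=; ring.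
have T2 : \sum_i wedge_field (d_dlambda b i) (arrow theta (tnth b i)) f k p =
    \sum_i \sum_a bivector_coef (inl i) (inr a) p.1 * frame (inl i) f p * frame (inr a) k p +
    \sum_a \sum_i bivector_coef (inr a) (inl i) p.1 * frame (inr a) f p * frame (inl i) k p.
  rewrite [X in _ = _ + X]exchange_big -big_split; apply: eq_bigr => i _ /=.
  rewrite /wedge_field (arrow_expand (tnth b i) f) // (arrow_expand (tnth b i) k) //.
  rewrite !mulr_sumr -sumrB -big_split; apply: eq_bigr => a _ /=; ring.
have T3 : arrow_bivector theta r f k p = \sum_a \sum_c
    bivector_coef (inr a) (inr c) p.1 * frame (inr a) f p * frame (inr c) k p.
  rewrite /arrow_bivector -/(left_differential f p) -/(left_differential k p).
  rewrite bivector_expand; apply: eq_bigr => a _; apply: eq_bigr => c _ /=.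
  by rewrite !left_differentialE //; ring.
rewrite /r_bivector_field T1 T2 T3 /frame_bivector big_sumType.
have -> : \sum_i \sum_B Pi (inl i) B p * frame (inl i) f p * frame B k p =
  \sum_i \sum_j bivector_coef (inl i) (inl j) p.1 * frame (inl i) f p * frame (inl j) k p +
  \sum_i \sum_a bivector_coef (inl i) (inr a) p.1 * frame (inl i) f p * frame (inr a) k p.
  by rewrite -big_split; apply: eq_bigr => i _; rewrite big_sumType.
have -> : \sum_a \sum_B Pi (inr a) B p * frame (inr a) f p * frame B k p =
  \sum_a \sum_i bivector_coef (inr a) (inl i) p.1 * frame (inr a) f p * frame (inl i) k p +
  \sum_a \sum_c bivector_coef (inr a) (inr c) p.1 * frame (inr a) f p * frame (inr c) k p.
  by rewrite -big_split; apply: eq_bigr => a _; rewrite big_sumType.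
by rewrite -[RHS]/(_ + _) !addrA.
Qed.

Lemma hamiltonian_inl f p i : smoothM f ->
  ham f (inl i) p = pairing p.1 (br (dual_gradient b f p) (tnth b i)) -
    left_differential f p (tnth b i).
Proof.
move=> sf; rewrite /hamiltonian big_sumType /=; congr (_ + _).
  have [l1 _] := linear_form_br br_lie (fun a x y => pairing_linear p.1 a x y).
  rewrite /dual_gradient (linear_form_sum _ _ _ (l1 _)).
  by apply: eq_bigr => j _; rewrite mulrC.
rewrite {2}(gbasis_sum (tnth b i)) (linear_form_sum _ _ _ (@linear_form_dual _ _ _)).
rewrite -sumrN; apply: eq_bigr => a _; rewrite left_differentialE //.
by rewrite mulNr.
Qed.

Lemma hamiltonian_inr f p : smoothM f ->
  \sum_a ham f (inr a) p *: tnth gbasis a =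
  dual_gradient b f p + sharp (r p.1) (left_differential f p).
Proof.
move=> sf; rewrite [X in X + _]gbasis_sum -big_split; apply: eq_bigr => a _ /=.
rewrite -scalerDl; congr (_ *: _); rewrite /hamiltonian big_sumType /=; congr (_ + _).
  rewrite /dual_gradient (linear_form_sum _ _ _ (@linear_form_dual _ _ _)).
  by apply: eq_bigr => i _; rewrite mulrC.
rewrite bivector_expand; apply: eq_bigr => c _.
rewrite (bigD1 a) //= big1 => [|j ja]; last first.
  by rewrite gcoord_basis eq_sym (negPf ja) mulr0 mul0r.
by rewrite gcoord_basis eqxx mulr1 addr0 left_differentialE // mulrC.
Qed.

(** Only the fields d/dlambda^i differentiate the coefficients, which are linear
    in lambda on the block of h, constant on the mixed blocks, and given by r
    on the block of g. *)
Lemma tensor_variationE f k q p : smoothM f -> smoothM k -> smoothM q ->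
  let X := dual_gradient b f p in
  let Y := br (dual_gradient b k p) (dual_gradient b q p) in
  let xi := left_differential f p in
  tensor_variation frame Pi f k q p = pairing p.1 (br X Y) - xi Y +
  \sum_i (pairing p.1 (br X (tnth b i)) - xi (tnth b i)) *
    dual_partial b i (fun mu => r mu (left_differential k p) (left_differential q p)) p.1.
Proof.
move=> sf sk sq X Y xi.
have Yh : Y \in h by apply: h_sub; exact: dual_gradient_mem.
have -> : pairing p.1 (br X Y) - xi Y = \sum_i ham f (inl i) p * coord b i Y.
  have lin : linear_form (fun Z => pairing p.1 (br X Z) - xi Z).
    move=> a u v; rewrite (br_linearr br_lie) pairing_linear linearP /=.
    by rewrite mulrBr; rewrite /GRing.scale /=; ring.
  have := linear_form_sum (index_enum _) (fun i => coord b i Y) (fun i => b`_i) lin.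
  rewrite -(coord_basis bh Yh) => ->; apply: eq_bigr => i _.
  by rewrite hamiltonian_inl // (tnth_nth 0) mulrC.
have -> : tensor_variation frame Pi f k q p =
  \sum_i ham f (inl i) p * (\sum_A \sum_B
    dual_partial b i (bivector_coef A B) p.1 * frame A k p * frame B q p).
  rewrite /tensor_variation.
  have HC A B : \sum_C ham f C p * frame C (Pi A B) p =
      \sum_i ham f (inl i) p * dual_partial b i (bivector_coef A B) p.1.
    rewrite big_sumType /= [X in _ + X]big1 ?addr0 // => a _.
    by rewrite (arrow_fst gG) mulr0.
  under [RHS]eq_bigr do rewrite mulr_sumr.
  rewrite [RHS]exchange_big; apply: eq_bigr => A _ /=.
  under [RHS]eq_bigr do rewrite mulr_sumr.
  rewrite [RHS]exchange_big; apply: eq_bigr => B _ /=.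
  by rewrite HC !mulr_suml; apply: eq_bigr => i _; rewrite !mulrA.
rewrite -big_split; apply: eq_bigr => i _ /=; rewrite hamiltonian_inl // -mulrDr.
congr (_ * _); rewrite big_sumType /=; congr (_ + _).
  rewrite /Y /dual_gradient (linear_form_br_sum _ _ _ _ _ _ br_lie).
    apply: eq_bigr => j _; rewrite big_sumType /= [X in _ + X]big1 => [|a _].
      rewrite addr0; apply: eq_bigr => j' _; rewrite (dual_partial_pairing _ _ (h_sub _ _)).
        by ring.
      by rewrite (mem_basis_tuple bh).
      by rewrite (mem_basis_tuple bh).
    by rewrite /dual_partial derive1_cst !mul0r.
  by move=> a u v; rewrite linearP.
rewrite (dual_partial_bivector bh _ _ _ _ r_smooth); apply: eq_bigr => a _.
rewrite big_sumType /= [X in X + _]big1 => [|j _]; last first.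
  by rewrite /dual_partial derive1_cst !mul0r.
by rewrite add0r; apply: eq_bigr => c _; rewrite !left_differentialE //; ring.
Qed.

(** The fields d/dlambda^i commute with the whole frame. *)
Lemma frame_curvatureE k q f p : smoothM k ->
  frame_curvature frame Pi k q f p = left_differential k p
    (br (\sum_a ham q (inr a) p *: tnth gbasis a) (\sum_a ham f (inr a) p *: tnth gbasis a)).
Proof.
move=> sk; rewrite (linear_form_br_sum _ _ _ _ _ _ br_lie (@linear_form_dual _ _ _)).
rewrite /frame_curvature big_sumType /= [X in X + _]big1 => [|i _].
  rewrite add0r; apply: eq_bigr => a _; rewrite big_sumType /= [X in X + _]big1 => [|i _].
    rewrite add0r; apply: eq_bigr => c _; rewrite left_differentialE //.
    by rewrite (arrow_bracket gG bh).
  by rewrite (arrow_d_dlambda gG bh) // subrr mulr0.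
rewrite big_sumType /= !big1 ?addr0 // => j _.
  by rewrite (arrow_d_dlambda gG bh) // subrr mulr0.
by rewrite (d_dlambda_comm bh) // subrr mulr0.
Qed.

End Jacobiator.


(** * The Jacobiator of the bivector field *)

Section MainIdentity.
Context {R : realType} {g : vectType R} {h : {vspace g}} {n : nat} {G : lieGroupType R n}.
Context (br : g -> g -> g) {theta : g -> (G -> R) -> R} {l : nat} (b : l.-tuple g).
Hypothesis br_lie : lie_bracket br.
Hypothesis h_sub : lie_subalgebra br h.
Hypothesis gG : is_lie_algebra_of br theta.
Hypothesis bh : basis_of h b.
Local Notation hdual := (dual (subvs_of h)).
Local Notation M := (hdual * G)%type.
Local Notation smoothM := (smooth_fun (@M_atlas R g h l b n G)).
Context (r : hdual -> bivector g).
Hypothesis r_smooth : smooth_bivector_valued b r.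
Implicit Types (f k q : M -> R) (p : M) (lambda : hdual) (xi eta zeta : dual g).
Local Notation P := (r_bivector_field b br theta r).
Local Notation inf := (infinitesimal_variation br b r).
Local Notation grad f p := (dual_gradient b f p).
Local Notation ldiff f p := (left_differential theta f p).

Definition yang_baxter lambda xi eta zeta : R :=
  \sum_i wedge12 (tnth b i)
     (fun xi' eta' => dual_partial b i (fun mu => r mu xi' eta') lambda)
     xi eta zeta
  - 2^-1 * schouten br (r lambda) (r lambda) xi eta zeta.

Lemma infinitesimal_variation0 lambda xi eta : inf 0 lambda xi eta = 0.
Proof.
have br0 X : br 0 X = 0.
  by have := br_linearl br_lie (-1) 0 0 X; rewrite !scaleN1r !addNr.
have coadg0 phi : coadg br 0 phi = 0.
  by apply/lfunP => X; rewrite (coadgE br_lie) br0 linear0 lfunE.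
have r0 phi : r lambda phi 0 = 0 by rewrite -sharpE lfunE.
rewrite /infinitesimal_variation !coadg0 (bivector_skew _ 0) !r0 oppr0 !addr0.
by rewrite big1 // => i _; rewrite br0 /pairing !linear0 mul0r.
Qed.

Lemma dual_partial_skew i lambda xi eta :
  dual_partial b i (fun mu => r mu xi eta) lambda =
  - dual_partial b i (fun mu => r mu eta xi) lambda.
Proof.
have := dual_partial_linear bh i (-1) lambda (r_smooth eta xi)
  (smooth_fun_cst (A := [set dual_chart h b]) 0).
rewrite mulN1r [X in _ = _ + X]derive1_cst addr0 => <-.
by congr dual_partial; apply/funext => mu; rewrite bivector_skew mulN1r addr0.
Qed.

(** X, Y, Z and xi, eta, zeta stand for the components along the dual of h and
    along G of the differentials of three functions.  The terms without r
    cancel by the Jacobi identity (those in lambda) or in pairs (the others).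
    The terms in X, eta and zeta are the derivative of r along lambda o ad X and
    the brackets of X with [sharp]: together they form the infinitesimal
    variation of r.  The terms in xi, eta and zeta alone form the dynamical
    Yang-Baxter expression, by [schouten_sharp]. *)
Lemma cyclic_identity lambda X Y Z xi eta zeta :
  let D i xi eta := dual_partial b i (fun mu => r mu xi eta) lambda in
  let T X xi Y Z eta zeta := pairing lambda (br X (br Y Z)) - xi (br Y Z) +
    \sum_i (pairing lambda (br X (tnth b i)) - xi (tnth b i)) * D i eta zeta in
  let H X xi := X + sharp (r lambda) xi in
  (T X xi Y Z eta zeta + eta (br (H Z zeta) (H X xi))) +
  (T Y eta Z X zeta xi + zeta (br (H X xi) (H Y eta))) +
  (T Z zeta X Y xi eta + xi (br (H Y eta) (H Z zeta))) =
  inf X lambda eta zeta + inf Y lambda zeta xi + inf Z lambda xi eta -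
  yang_baxter lambda xi eta zeta.
Proof.
move=> D T H.
have jac : pairing lambda (br X (br Y Z)) + pairing lambda (br Y (br Z X)) +
    pairing lambda (br Z (br X Y)) = 0.
  by rewrite /pairing -!linearD /= (br_jacobi br_lie) linear0 linear0.
have brN (phi : dual g) u v : phi (br u v) = - phi (br v u).
  by rewrite (brC br_lie) linearN.
have brD (phi : dual g) u v u' v' : phi (br (u + u') (v + v')) =
    phi (br u v) + phi (br u v') + phi (br u' v) + phi (br u' v').
  have [l1 l2] := linear_form_br br_lie (linear_form_dual phi).
  have := l1 (v + v') 1 u u'; have := l2 u 1 v v'; have := l2 u' 1 v v'.
  by rewrite !scale1r !mul1r => -> -> ->; ring.
set x := sharp (r lambda) xi; set y := sharp (r lambda) eta; set z := sharp (r lambda) zeta.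
have TE X' xi' Y' Z' eta' zeta' : T X' xi' Y' Z' eta' zeta' =
    pairing lambda (br X' (br Y' Z')) - xi' (br Y' Z') +
    \sum_i pairing lambda (br X' (tnth b i)) * D i eta' zeta' -
    \sum_i xi' (tnth b i) * D i eta' zeta'.
  rewrite /T -[RHS]addrA -sumrB; congr (_ + _); apply: eq_bigr => i _.
  by rewrite mulrBl.
have infE X' eta' zeta' : inf X' lambda eta' zeta' =
    \sum_i pairing lambda (br X' (tnth b i)) * D i eta' zeta' -
    eta' (br X' (sharp (r lambda) zeta')) + zeta' (br X' (sharp (r lambda) eta')).
  rewrite /infinitesimal_variation [r lambda (coadg _ _ _) _]bivector_skew.
  by rewrite -!(sharpE (r lambda)) !(coadgE br_lie).
have ybE : yang_baxter lambda xi eta zeta =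
    \sum_i xi (tnth b i) * D i eta zeta + \sum_i eta (tnth b i) * D i zeta xi +
    \sum_i zeta (tnth b i) * D i xi eta -
    (xi (br y z) + eta (br z x) + zeta (br x y)).
  rewrite /yang_baxter (schouten_sharp br_lie); congr (_ - _); last by field.
  rewrite -!big_split; apply: eq_bigr => i _ /=.
  by rewrite /wedge12 (dual_partial_skew i lambda xi zeta) mulrN opprK.
rewrite !TE !infE ybE /H -/x -/y -/z !brD.
rewrite (brN eta z X) (brN zeta x Y) (brN xi y Z).
have -> : pairing lambda (br X (br Y Z)) =
  - (pairing lambda (br Y (br Z X)) + pairing lambda (br Z (br X Y))).
  by apply/eqP; rewrite -addr_eq0 addrA jac.
by ring.
Qed.

(** Whatever r is, the field is a biderivation, and its Jacobiator depends on
    the differentials of the three functions only. *)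
Lemma r_bivector_field_poisson :
  bivector_field (M_atlas b) P /\
  forall f k q p, smoothM f -> smoothM k -> smoothM q ->
  P f (P k q) p + P k (P q f) p + P q (P f k) p =
  inf (grad f p) p.1 (ldiff k p) (ldiff q p) +
  inf (grad k p) p.1 (ldiff q p) (ldiff f p) +
  inf (grad q p) p.1 (ldiff f p) (ldiff k p) -
  yang_baxter p.1 (ldiff f p) (ldiff k p) (ldiff q p).
Proof.
pose S : (M -> R) -> Prop := smoothM.
pose Fr := frame (h := h) theta b.
pose Pi A B (p : M) := bivector_coef br b r A B p.1.
have Scst a : S (fun=> a) by exact: smooth_fun_cst.
have Sadd f k : S f -> S k -> S (fun p => f p + k p).
  exact: (smooth_fun_add (M_open bh)).
have Smul f k : S f -> S k -> S (fun p => f p * k p).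
  exact: (smooth_fun_mul (M_open bh)).
have SPi A B : S (Pi A B).
  by apply: (smooth_M_fst bh); exact: bivector_coef_smooth.
have SE A f : S f -> S (Fr A f) by exact: (frame_smooth gG bh).
have El A a f k p : S f -> S k -> Fr A (fun x => a * f x + k x) p = a * Fr A f p + Fr A k p.
  exact: (frame_linear gG bh).
have Em A f k p : S f -> S k -> Fr A (fun x => f x * k x) p = f p * Fr A k p + Fr A f p * k p.
  exact: (frame_leibniz gG bh).
have Psk A B p : Pi B A p = - Pi A B p by exact: bivector_coef_skew.
have PE f k : S f -> S k -> P f k = frame_bivector Fr Pi f k.
  by move=> sf sk; apply/funext => p; rewrite (r_bivector_frame br_lie gG bh).
have SP f k : S f -> S k -> S (frame_bivector Fr Pi f k).
  exact: (frame_bivector_smooth Scst Sadd Smul SPi SE).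
split.
  split.
  - by move=> f k sf sk; rewrite PE //; exact: SP.
  - by move=> f k p sf sk; rewrite !PE //; exact: frame_bivector_skew.
  - move=> a f f' k p sf sf' sk; rewrite !PE //; last first.
      exact: (smooth_fun_linear (M_open bh)).
    exact: (frame_bivector_linear _ El).
  - move=> f f' k p sf sf' sk; rewrite !PE //; last exact: Smul.
    exact: (frame_bivector_leibniz _ Em).
move=> f k q p sf sk sq.
rewrite (PE k q) // (PE q f) // (PE f k) // !PE //; try exact: SP.
rewrite (frame_jacobiator Scst Sadd Smul SPi SE El Em Psk) //.
rewrite /Fr /Pi !(tensor_variationE br_lie h_sub gG bh r_smooth) //.
rewrite !(frame_curvatureE br_lie gG bh) // !(hamiltonian_inr gG bh) //.
exact: cyclic_identity.
Qed.

End MainIdentity.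

Theorem proposition2p1 (R : realType)
    (g : vectType R) (br : g -> g -> g) (br_lie : lie_bracket br)
    (h : {vspace g}) (h_sub : lie_subalgebra br h)
    (n : nat) (G : lieGroupType R n)
    (theta : g -> (G -> R) -> R) (g_lie_G : is_lie_algebra_of br theta)
    (m : nat) (H : lieGroupType R m) (iota : H -> G)
    (H_sub : is_connected_lie_subgroup theta h iota)
    (l : nat) (b : l.-tuple g) (b_basis : basis_of h b)
    (r : dual (subvs_of h) -> bivector g)
    (r_smooth : smooth_bivector_valued b r) :
  triangular_dynamical_r_matrix b br theta iota r
  <-> poisson_tensor (M_atlas b) (r_bivector_field b br theta r).
Proof.
have [PB PJ] := r_bivector_field_poisson br_lie h_sub g_lie_G b_basis r_smooth.
have gradh := dual_gradient_mem (G := G) b_basis.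
split=> [[equi yb]|[_ J]].
  split=> // f k q p sf sk sq.
  rewrite PJ // [yang_baxter _ _ _ _ _ _ _]yb subr0.
  have inv := iffLR (equivariant_invariant g_lie_G H_sub r) equi.
  have inf0 := invariant_infinitesimal br_lie g_lie_G H_sub b_basis r_smooth inv.
  by rewrite !inf0 ?addr0.
(* functions with prescribed differentials at (lambda, 1) isolate the two kinds
   of terms of the Jacobiator *)
have inf_0 := infinitesimal_variation0 b br_lie r.
have ldE (f : dual (subvs_of h) * G -> R) p (xi : dual g) : smooth_fun (M_atlas b) f ->
    (forall Y, arrow theta Y f p = xi Y) -> left_differential theta f p = xi.
  move=> sf E; apply/lfunP => Y; rewrite -E.
  exact: (left_differentialE g_lie_G b_basis).
have yb lambda xi eta zeta : yang_baxter br b r lambda xi eta zeta = 0.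
  have [f [sf f0 /(ldE _ _ _ sf) fxi]] := covector_onto g_lie_G b_basis (lambda, 1%g) xi (mem0v h).
  have [k [sk k0 /(ldE _ _ _ sk) keta]] := covector_onto g_lie_G b_basis (lambda, 1%g) eta (mem0v h).
  have [q [sq q0 /(ldE _ _ _ sq) qzeta]] := covector_onto g_lie_G b_basis (lambda, 1%g) zeta (mem0v h).
  have := J f k q (lambda, 1%g) sf sk sq; rewrite PJ // f0 k0 q0 fxi keta qzeta !inf_0.
  by rewrite !add0r => /eqP; rewrite oppr_eq0 => /eqP.
split; last exact: yb.
apply/(equivariant_invariant g_lie_G H_sub r).
apply: (invariant_all br_lie g_lie_G H_sub b_basis r_smooth) => X lambda xi eta Xh.
have [f [sf fX /(ldE _ _ _ sf) f0]] := covector_onto g_lie_G b_basis (lambda, 1%g) 0 Xh.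
have [k [sk k0 /(ldE _ _ _ sk) kxi]] := covector_onto g_lie_G b_basis (lambda, 1%g) xi (mem0v h).
have [q [sq q0 /(ldE _ _ _ sq) qeta]] := covector_onto g_lie_G b_basis (lambda, 1%g) eta (mem0v h).
have := J f k q (lambda, 1%g) sf sk sq; rewrite PJ // fX k0 q0 f0 kxi qeta !inf_0.
by rewrite !addr0 yb subr0.
Qed.
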